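(* Assume $N\ge5$. Take a point $x^0=(x^0_1,\dots,x^0_N)\in\mathbb{R}^N$, parameters $\alpha_1,\dots,\alpha_N>1+N/2$, and let $$p(x)=\sum_{i=1}^N\alpha_i(x_i-x_i^0)^2 .$$ Then there exists a solution $u$ of $\Delta^2u=e^u$ in $\mathbb{R}^N$ such that $$u(x)=-p(x)+\mathcal O(|x|^{4-N})\quad\text{as }|x|\to\infty .$$ In particular, $u$ is stable outside a compact set (resp. stable, if $\min_{i=1,\dots,N}\alpha_i$ is large enough), and $u$ is not radial about any point if the coefficients $\alpha_i$ are not all equal.
   Context: For an open set $\Omega\subset\mathbb{R}^N$ consider the inequality $$\int_\Omega e^u\varphi^2\,dx\le\int_\Omega|\Delta\varphi|^2\,dx\quad\text{for all }\varphi\in H^2(\Omega)\cap H^1_0(\Omega).\qquad (S_\Omega)$$ The solution $u$ is stable if $(S_\Omega)$ holds with $\Omega=\mathbb{R}^N$, and stable outside a compact set if $(S_\Omega)$ holds with $\Omega=\mathbb{R}^N\setminus K$ for some compact $K\subset\mathbb{R}^N$. *)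

(* Defs.v *)
From HB Require Import structures.
From mathcomp Require Import all_boot all_order all_algebra.
From mathcomp Require Import all_classical all_reals all_analysis.

Set Implicit Arguments.
Unset Strict Implicit.
Unset Printing Implicit Defensive.

Import Order.TTheory GRing.Theory Num.Theory.
Import numFieldNormedType.Exports.

Local Open Scope classical_set_scope.
Local Open Scope ring_scope.

(* R^n is 'rV[R]_n.  The normed structure which the library puts on it is the
   sup norm; it gives the usual topology and the usual partial derivatives, but
   |x| in statements about R^n is the Euclidean norm below. *)
Definition enorm (R : realType) (n : nat) (x : 'rV[R]_n) : R :=
  Num.sqrt (\sum_(i < n) x 0 i ^+ 2).

Section measurable_rV.
Variables (R : realType) (n : nat).

Definition rV_display : measure_display. Proof. exact: default_measure_display. Qed.

Let coor (i : 'I_n) (x : 'rV[R]_n) : measurableTypeR R := x 0 i.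

(* The sigma-algebra generated by the coordinates, i.e. the Borel one. *)
Let rV_set0 : g_sigma_preimage coor set0.
Proof. exact: sigma_algebra0. Qed.

Let rV_setC A : g_sigma_preimage coor A -> g_sigma_preimage coor (~` A).
Proof. exact: sigma_algebraC. Qed.

Let rV_bigcup (F : (set 'rV[R]_n)^nat) :
  (forall i, g_sigma_preimage coor (F i)) ->
  g_sigma_preimage coor (\bigcup_i F i).
Proof. exact: sigma_algebra_bigcup. Qed.

HB.instance Definition _ := @isMeasurable.Build rV_display
  'rV[R]_n (g_sigma_preimage coor) rV_set0 rV_setC rV_bigcup.

Lemma measurable_coor (i : 'I_n) :
  measurable_fun [set: 'rV[R]_n] (fun x : 'rV[R]_n => x 0 i : measurableTypeR R).
Proof.
move=> _ Y mY; rewrite setTI; apply: sub_sigma_algebra => /=.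
rewrite -bigcup_seq/=; exists i => /=; first by rewrite mem_index_enum.
by exists Y => //; rewrite setTI.
Qed.

Lemma measurable_fun_rV d (T : measurableType d) (f : T -> 'rV[R]_n) :
  (forall i, measurable_fun [set: T] (fun x => f x 0 i : measurableTypeR R)) ->
  measurable_fun [set: T] f.
Proof.
move=> mf _ A mA; rewrite setTI; move: A mA.
pose G := [set A | measurable (f @^-1` A)].
suff : g_sigma_preimage coor `<=` G by [].
apply: smallest_sub; first split.
- by rewrite /G /= preimage_set0.
- by move=> A GA; rewrite /G /= setTD preimage_setC; exact: measurableC.
- by move=> F GF; rewrite /G /= preimage_bigcup; exact: bigcupT_measurable.
rewrite -bigcup_seq /=; apply: bigcup_sub => i _ A [B mB <-].
rewrite /G /= setTI -comp_preimage.
have := mf i measurableT B mB.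
by rewrite setTI.
Qed.

End measurable_rV.


Section lebesgue_rV.
Variable R : realType.
Local Open Scope ereal_scope.

Definition rV_cons (n : nat) (p : measurableTypeR R * 'rV[R]_n) : 'rV[R]_n.+1 :=
  row_mx (const_mx p.1 : 'rV[R]_1) p.2.

Definition rV_uncons (n : nat) (x : 'rV[R]_n.+1) : measurableTypeR R * 'rV[R]_n :=
  (x 0%R 0%R, \row_(j < n) x 0%R (lift 0%R j)).

Lemma rV_consK n : cancel (@rV_cons n) (@rV_uncons n).
Proof.
case=> a x; rewrite /rV_uncons /rV_cons /=; congr (_, _).
  rewrite (_ : 0%R = lshift n (0%R : 'I_1)); last exact/val_inj.
  by rewrite (@row_mxEl _ 1 1 n) mxE.
apply/rowP => j; rewrite mxE.
rewrite (_ : lift _ _ = rshift 1 j); last exact/val_inj.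
by rewrite (@row_mxEr _ 1 1 n).
Qed.

Lemma measurable_rV_cons n : measurable_fun setT (@rV_cons n).
Proof.
apply: measurable_fun_rV => i.
case: (split_ordP (i : 'I_(1 + n))) => j ->.
- rewrite (_ : (fun _ => _) = fst); first exact: measurable_fst.
  by apply/funext => p; rewrite /rV_cons (@row_mxEl _ 1 1 n) mxE.
- rewrite (_ : (fun _ => _) =
      (fun x : 'rV[R]_n => x 0%R j : measurableTypeR R) \o snd).
    by apply: measurableT_comp; [exact: measurable_coor|exact: measurable_snd].
  by apply/funext => p; rewrite /rV_cons (@row_mxEr _ 1 1 n).
Qed.

Lemma measurable_rV_uncons n : measurable_fun setT (@rV_uncons n).
Proof.
apply: measurable_fun_pair => /=; first exact: measurable_coor.
apply: measurable_fun_rV => i.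
under eq_fun do rewrite mxE.
exact: measurable_coor.
Qed.

Section step.
Variables (n : nat) (mu : {sigma_finite_measure set 'rV[R]_n -> \bar R}).

Definition lebesgue_rV_step : set 'rV[R]_n.+1 -> \bar R :=
  pushforward (@lebesgue_measure R \x mu) (@rV_cons n).

Let step0 : lebesgue_rV_step set0 = 0.
Proof. by rewrite /lebesgue_rV_step /pushforward preimage_set0 measure0. Qed.

Let step_ge0 A : 0 <= lebesgue_rV_step A.
Proof. by rewrite /lebesgue_rV_step /pushforward measure_ge0. Qed.

Let step_sigma_additive : semi_sigma_additive lebesgue_rV_step.
Proof.
have mc := @measurable_rV_cons n.
move=> F mF tF mUF; rewrite /lebesgue_rV_step /pushforward preimage_bigcup.
apply: measure_semi_sigma_additive.
- by move=> k; rewrite -[X in measurable X]setTI; exact: mc.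
- apply/trivIsetP => /= i j _ _ ij; rewrite -preimage_setI.
  by move/trivIsetP : tF => /(_ _ _ _ _ ij) ->//; rewrite preimage_set0.
- by rewrite -preimage_bigcup -[X in measurable X]setTI; exact: mc.
Qed.

HB.instance Definition _ := isMeasure.Build _ _ _
  lebesgue_rV_step step0 step_ge0 step_sigma_additive.

Let step_sigma_finite : sigma_finite setT lebesgue_rV_step.
Proof.
have /sigma_finiteP[F [FT ndF Foo]] := sigma_finiteT (@lebesgue_measure R).
have /sigma_finiteP[G [GT ndG Goo]] := sigma_finiteT mu.
exists (fun k => @rV_uncons n @^-1` (F k `*` G k)).
  rewrite -preimage_bigcup (_ : \bigcup_k _ = setT) ?preimage_setT//.
  rewrite -subTset => -[x y] _.
  have [i _ Fix] : (\bigcup_k F k) x by rewrite -FT.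
  have [j _ Gjy] : (\bigcup_k G k) y by rewrite -GT.
  exists (maxn i j) => //; split.
    by move: x Fix; exact/subsetPset/ndF/leq_maxl.
  by move: y Gjy; exact/subsetPset/ndG/leq_maxr.
move=> k; have [mF Fk] := Foo k; have [mG Gk] := Goo k; split.
  by rewrite -[X in measurable X]setTI; apply: measurable_rV_uncons => //;
     exact: measurableX.
rewrite /lebesgue_rV_step /pushforward -comp_preimage.
rewrite (_ : _ \o _ = id); last by apply/funext => p; exact: rV_consK.
by rewrite preimage_id product_measure1E// lte_mul_pinfty// ge0_fin_numE.
Qed.

HB.instance Definition _ := @Measure_isSigmaFinite.Build _ _ _
  lebesgue_rV_step step_sigma_finite.

End step.

(* The n-dimensional Lebesgue measure, as an iterated product. *)
Fixpoint lebesgue_rV (n : nat) : {sigma_finite_measure set 'rV[R]_n -> \bar R} :=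
  match n with
  | 0 => \d_(0%R : 'rV[R]_0)
  | n'.+1 => lebesgue_rV_step (lebesgue_rV n')
  end.

Lemma measurable_box n (A : 'I_n -> set (measurableTypeR R)) :
  (forall i, measurable (A i)) ->
  measurable [set x : 'rV[R]_n | forall i, A i (x 0%R i)].
Proof.
move=> mA; rewrite (_ : mkset _ =
    \bigcap_(i in [set: 'I_n]) (fun x : 'rV[R]_n => x 0%R i) @^-1` A i).
  apply: fin_bigcap_measurable => // i _.
  rewrite -[X in measurable X]setTI.
  exact: (measurable_coor i measurableT (mA i)).
by apply/seteqP; split => x /= Ax i; [move=> _; exact: Ax|exact: (Ax i I)].
Qed.

Lemma lebesgue_rV_box n (A : 'I_n -> set (measurableTypeR R)) :
  (forall i, measurable (A i)) ->
  lebesgue_rV n [set x | forall i, A i (x 0%R i)] =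
  \prod_(i < n) lebesgue_measure (A i).
Proof.
elim: n A => [|n IH] A mA.
  rewrite big_ord0 /= diracE mem_set//.
  by case.
rewrite big_ord_recl /= /lebesgue_rV_step /pushforward.
have mB : measurable [set x : 'rV[R]_n | forall i, A (lift 0%R i) (x 0%R i)].
  exact: (@measurable_box _ (fun i => A (lift 0%R i))).
rewrite -(IH (fun i => A (lift 0%R i)))//.
rewrite -(product_measure1E (@lebesgue_measure R) (lebesgue_rV n) (mA 0%R) mB).
congr (product_measure1 _ _ _); apply/seteqP.
have cons0 a (x : 'rV[R]_n) : rV_cons (a, x) 0%R 0%R = a.
  by have [] := rV_consK (a, x).
have consS a (x : 'rV[R]_n) i : rV_cons (a, x) 0%R (lift 0%R i) = x 0%R i.
  by have [_ /rowP/(_ i)] := rV_consK (a, x); rewrite mxE.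
split => -[a x] /=.
  move=> Aax; split; first by have := Aax 0%R; rewrite cons0.
  by move=> i; have := Aax (lift 0%R i); rewrite consS.
move=> [Aa Ax] i; case: (unliftP 0%R i) => [j ->|->]; last by rewrite cons0.
by rewrite consS; exact: Ax.
Qed.

End lebesgue_rV.

Section calculus.
Variables (R : realType) (N : nat).
Implicit Types (f g : 'rV[R]_N -> R) (s : seq 'I_N).

Definition partial (i : 'I_N) f : 'rV[R]_N -> R :=
  fun x => 'D_(delta_mx 0 i) f x.

(* [:: i1; ...; ik] stands for d_i1 ... d_ik. *)
Definition partials s f : 'rV[R]_N -> R := foldr partial f s.

Definition Ck (k : nat) f : Prop :=
  (forall s, (size s <= k)%N -> continuous (partials s f)) /\
  (forall s, (size s < k)%N ->
     forall i x, derivable (partials s f) x (delta_mx 0 i)).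

Definition smooth f : Prop := forall k, Ck k f.

Definition laplacian f : 'rV[R]_N -> R :=
  fun x => \sum_(i < N) partials [:: i; i] f x.

Definition is_solution (u : 'rV[R]_N -> R) : Prop :=
  Ck 4 u /\ forall x, laplacian (laplacian u) x = expR (u x).

(* f(x) = O(g(x)) as |x| -> +oo *)
Definition bigO_infty f g : Prop :=
  exists C M : R, forall x, M <= enorm x -> `|f x| <= C * `|g x|.

Definition radial_about (c : 'rV[R]_N) f : Prop :=
  exists g : R -> R, forall x, f x = g (enorm (x - c)).

End calculus.

Section sobolev.
Variables (R : realType) (N : nat) (Omega : set 'rV[R]_N).
Implicit Types (f g v w : 'rV[R]_N -> R).
Local Notation mu := (lebesgue_rV R N).

Definition test_function f : Prop :=
  smooth f /\ exists K, [/\ compact K, K `<=` Omega & forall x, ~ K x -> f x = 0].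

Definition L2 f : Prop :=
  measurable_fun Omega f /\ (\int[mu]_(x in Omega) (f x ^+ 2)%:E < +oo)%E.

Definition weak_partial (i : 'I_N) f g : Prop :=
  forall psi, test_function psi ->
  (\int[mu]_(x in Omega) (f x * partial i psi x)%:E
   = - \int[mu]_(x in Omega) (g x * psi x)%:E)%E.

(* The Sobolev space W^{k,2}(Omega), with functions as representatives of classes. *)
Fixpoint sobolev_H (k : nat) f : Prop :=
  L2 f /\
  if k is k'.+1 then forall i, exists2 g, weak_partial i f g & sobolev_H k' g
  else True.

(* The closure of C_c^oo(Omega) in H^1(Omega). *)
Definition sobolev_H10 f : Prop :=
  L2 f /\ exists2 g : 'I_N -> 'rV[R]_N -> R,
    forall i, L2 (g i) /\ weak_partial i f (g i) &
    forall e : R, 0 < e -> exists2 psi, test_function psi &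
      (\int[mu]_(x in Omega) ((f x - psi x) ^+ 2)%:E
       + \sum_(i < N) \int[mu]_(x in Omega) ((g i x - partial i psi x) ^+ 2)%:E
       < e%:E)%E.

(* w is the Laplacian of f, for f in H^2(Omega); it is determined up to a null
   set. *)
Definition weak_laplacian f w : Prop :=
  exists g h : 'I_N -> 'rV[R]_N -> R,
    [/\ forall i, L2 (g i) /\ weak_partial i f (g i),
        forall i, L2 (h i) /\ weak_partial i (g i) (h i) &
        forall x, w x = \sum_(i < N) h i x].

Definition stability_inequality (u : 'rV[R]_N -> R) : Prop :=
  forall phi w, sobolev_H 2 phi -> sobolev_H10 phi -> weak_laplacian phi w ->
  (\int[mu]_(x in Omega) (expR (u x) * phi x ^+ 2)%:E
   <= \int[mu]_(x in Omega) (w x ^+ 2)%:E)%E.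

End sobolev.

Definition stable (R : realType) (N : nat) (u : 'rV[R]_N -> R) : Prop :=
  stability_inequality setT u.

Definition stable_outside_compact (R : realType) (N : nat)
    (u : 'rV[R]_N -> R) : Prop :=
  exists2 K : set 'rV[R]_N, compact K & stability_inequality (~` K) u.

(* Main.v *)
From HB Require Import structures.
Require Import Defs.
From mathcomp Require Import all_boot all_order all_algebra.
From mathcomp Require Import ring lra.
From mathcomp Require Import all_classical all_reals all_analysis.
From mathcomp Require Import measurable_realfun.
Import Order.TTheory GRing.Theory Num.Theory.
Import numFieldNormedType.Exports.
Local Open Scope classical_set_scope.
Local Open Scope ring_scope.

(** The Gaussians exp(- sum_i b_i (x_i - x0_i)^2) with diagonal exponents have an
    explicit heat flow, which consists of Gaussians of the same kind, and
    Delta^-2 is the integral of t exp(t Delta) over t > 0. Therefore products and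
    Delta^-2 act on positive superpositions of such Gaussians, that is, on
    Laplace transforms in the variables (x_i - x0_i)^2 of finite measures on the
    space of exponents, and the equation v = Delta^-2 exp(- p + v) for the
    correction v = u + p is solved there: it reads mu = exp(T mu), where exp is
    taken for the convolution and T is linear and shrinks the total mass by a
    factor at least 4. Positivity makes the iteration a sum of positive measures,
    with total mass at most 2. Hence v is smooth, 0 <= v <= 1/2, and the decay of
    v is read off the formula for T.

    For stability put s = 1 / (1/2 + |x - x0|^2). Since Delta s <= - 2 s^2 when
    N >= 5, integrating - Delta phi against s phi gives
    int (s phi)^2 <= int (Delta phi)^2 for phi in H^2 with no boundary term, and
    exp u <= s^2 because v <= 1/2 and p >= 7/2 |x - x0|^2. So u is stable for all
    admissible coefficients, not only for large ones. If u were radial about c,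
    the boundedness of v would force c = x0 and then equal coefficients. *)

Set Implicit Arguments.
Unset Strict Implicit.
Unset Printing Implicit Defensive.

(** * Finite measures *)

Section finite_measures.
Local Open Scope ereal_scope.

(** The obstacle is regularity: each derivative of a Gaussian brings down powers of its exponents,
    and a finite measure need not have moments. The Gaussians are therefore weighted by exp(- l
    |w|), where |w| is the sum of the exponents. The weight is a translation of the Laplace
    variables by l, so it respects products, and it makes all derivatives bounded in w. Conjugating
    T by the weight costs at most exp(l sum_i alpha_i), and l is chosen to keep this factor below 2.
    The dimension enters through the decay (1 + 4 b t)^(-N/2) of the flow: t times it is integrable
    exactly when N >= 5. With exponents at least 7/2, the value of 1 + N/2 at N = 5, the map T
    shrinks mass by at least 49; a factor 4 is enough, because mass 2 then becomes at most 1/2 and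
    exp(1/2) <= 2. Measures are handled only through their integrals of nonnegative functions, so
    Tonelli and monotone convergence suffice and no equality of measures has to be proved. *)

Lemma finite_measure_pack d (T : measurableType d) (R : realType)
    (mu : {measure set T -> \bar R}) :
  mu setT < +oo -> exists nu : {finite_measure set T -> \bar R}, nu = mu :> (set T -> \bar R).
Proof.
move=> muoo.
have H : fin_num_fun mu.
  move=> A mA; rewrite ge0_fin_numE// (le_lt_trans _ muoo)//.
  by apply: le_measure; rewrite ?inE.
have sf : sigma_finite setT mu by apply: fin_num_fun_sigma_finite => //; rewrite measure0.
pose H1 := isFinite.Build _ _ _ (Measure.sort mu) H.
pose H2 := isSFinite.Build _ _ _ (Measure.sort mu) (sfinite_measure_sigma_finite sf).
pose H3 := isSigmaFinite.Build _ _ _ (Measure.sort mu) sf.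
pose nu := HB.pack_for (FiniteMeasure.type T R) (Measure.sort mu) H1 H2 H3.
by exists nu.
Qed.

Lemma density_measure d (T : measurableType d) (R : realType)
    (m : {measure set T -> \bar R}) (w : T -> R) :
  measurable_fun setT w -> (forall x, 0 <= w x)%R ->
  exists nu : {measure set T -> \bar R}, forall A, nu A = \int[m]_(x in A) (w x)%:E.
Proof.
move=> mw w0; pose f A := \int[m]_(x in A) (w x)%:E.
have f0 : f set0 = 0 by rewrite /f integral_set0.
have f_ge0 A : 0 <= f A by by apply: integral_ge0 => x _; rewrite lee_fin.
have fs : semi_sigma_additive f.
  by apply: semi_sigma_additive_nng_induced => [|x]; [exact/measurable_EFinP|rewrite lee_fin].
pose X := isMeasure.Build _ _ _ f f0 f_ge0 fs.
pose nu : {measure set T -> \bar R} := HB.pack f X.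
by exists nu.
Qed.

Import HBNNSimple.

Lemma ge0_integral_density d (T : measurableType d) (R : realType)
    (m nu : {measure set T -> \bar R}) (w : T -> R) (g : T -> \bar R) :
  measurable_fun setT w -> (forall x, 0 <= w x)%R ->
  measurable_fun setT g -> (forall x, 0 <= g x) ->
  (forall A, nu A = \int[m]_(x in A) (w x)%:E) ->
  \int[nu]_x g x = \int[m]_x ((w x)%:E * g x).
Proof.
move=> mw w0 mg g0 nuE.
have H (h : {nnsfun T >-> R}) :
    \int[nu]_x (h x)%:E = \int[m]_x ((w x)%:E * (h x)%:E).
  rewrite integralT_nnsfun sintegralE.
  have -> : \int[m]_x ((w x)%:E * (h x)%:E) =
      \int[m]_x (\sum_(r \in range h) (w x)%:E * (r * \1_(h @^-1` [set r]) x)%:E).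
    apply: eq_integral => x _; rewrite {1}(fimfunE h) -fsumEFin// ge0_mule_fsumr//.
    by move=> r; rewrite EFinM nnfun_muleindic_ge0.
  rewrite ge0_integral_fsum//; last 2 first.
  - by move=> r; apply: emeasurable_funM; apply/measurable_EFinP => //;
       apply: measurable_funM => //; exact: measurable_indic.
  - by move=> r x _; apply: mule_ge0; rewrite ?lee_fin // -lee_fin EFinM nnfun_muleindic_ge0.
  apply: eq_fsbigr => r; rewrite inE => -[t _ <-].
  under eq_integral do rewrite EFinM muleCA.
  rewrite ge0_integralZl//; last 3 first.
  - by apply: emeasurable_funM; apply/measurable_EFinP => //; exact: measurable_indic.
  - by move=> x _; rewrite mule_ge0// ?lee_fin// lee_fin.
  - by rewrite lee_fin.
  congr (_ * _); rewrite nuE integral_mkcond; apply: eq_integral => x _.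
  by rewrite epatch_indic /=.
pose g_ := nnsfun_approx measurableT mg.
transitivity (limn (fun n => \int[nu]_x (g_ n x)%:E)).
  rewrite -monotone_convergence//.
  - apply: eq_integral => x _; apply/esym/cvg_lim => //.
    exact: cvg_nnsfun_approx.
  - by move=> n; exact/measurable_EFinP.
  - by move=> n x _; rewrite lee_fin.
  - by move=> x _ a b ab; rewrite lee_fin; exact/lefP/nd_nnsfun_approx.
under eq_fun do rewrite H.
rewrite -monotone_convergence//.
- apply: eq_integral => x _; apply/cvg_lim => //.
  by apply: cvgeZl => //; exact: cvg_nnsfun_approx.
- by move=> n; apply: emeasurable_funM; exact/measurable_EFinP.
- by move=> n x _; rewrite mule_ge0// ?lee_fin// lee_fin.
- move=> x _ a b ab; rewrite lee_pmul// ?lee_fin//.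
  exact/lefP/nd_nnsfun_approx.
Qed.

(** Convolution, scaling and the flow are all images of a density, hence instances of this
    construction. *)
Lemma weighted_image d d' (X : measurableType d) (T : measurableType d')
    (R : realType) (m : {measure set X -> \bar R}) (w : X -> R) (phi : X -> T) :
  measurable_fun setT w -> (forall x, 0 <= w x)%R -> measurable_fun setT phi ->
  \int[m]_x (w x)%:E < +oo ->
  exists nu : {finite_measure set T -> \bar R},
    forall g : T -> \bar R, measurable_fun setT g -> (forall x, 0 <= g x) ->
      \int[nu]_x g x = \int[m]_x ((w x)%:E * g (phi x)).
Proof.
move=> mw w0 mphi woo.
have [m1 m1E] := density_measure m mw w0.
pose m2' : {measure set T -> \bar R} := pushforward m1 phi.
pose m2 := m2' mphi.
have m2oo : m2 setT < +oo.
  by rewrite /m2/= /pushforward preimage_setT m1E.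
have [nu nuE] := finite_measure_pack m2oo; exists nu => g mg g0.
transitivity (\int[m2]_x g x).
  by apply: eq_measure_integral => A mA _; exact: (congr1 (@^~ A) nuE).
rewrite ge0_integral_pushforward// preimage_setT.
apply: (ge0_integral_density mw w0 _ _ m1E); first exact: measurableT_comp.
by move=> x /=.
Qed.

Lemma measure_sum d (T : measurableType d) (R : realType)
    (mu : nat -> {finite_measure set T -> \bar R}) :
  \sum_(k <oo) mu k setT < +oo ->
  exists nu : {finite_measure set T -> \bar R},
    forall g : T -> \bar R, measurable_fun setT g -> (forall x, 0 <= g x) ->
      \int[nu]_x g x = \sum_(k <oo) \int[mu k]_x g x.
Proof.
move=> muoo.
have [nu nuE] := @finite_measure_pack _ _ _ (mseries mu 0) muoo.
exists nu => g mg g0; rewrite -ge0_integral_measure_series//.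
by apply: eq_measure_integral => A mA _; exact: (congr1 (@^~ A) nuE).
Qed.

End finite_measures.

(** * Laplace transforms of finite measures *)

Lemma cvg_nneseriesE (R : realType) (a : nat -> R) (A : R) :
  (forall k, 0 <= a k) -> (A%:E = \sum_(k <oo) (a k)%:E)%E ->
  \sum_(k < n) a k @[n --> \oo] --> A.
Proof.
move=> a0 AE.
have H : (\sum_(0 <= k < n) (a k)%:E @[n --> \oo] --> A%:E)%E.
  by rewrite AE; apply: is_cvg_ereal_nneg_natsum => k _; rewrite lee_fin.
move/fine_cvg: H; apply: cvg_trans; apply: near_eq_cvg; apply: nearW => n /=.
by rewrite sumEFin big_mkord.
Qed.

Lemma nneseries_EFin (R : realType) (a : nat -> R) (A : R) :
  \sum_(k < n) a k @[n --> \oo] --> A -> (\sum_(k <oo) (a k)%:E = A%:E)%E.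
Proof.
move=> aA; apply/cvg_lim => //.
have H : (\sum_(k < n) a k)%:E @[n --> \oo] --> A%:E by apply: cvg_EFin => //; exact: nearW.
apply: cvg_trans H; apply: near_eq_cvg; apply: nearW => n /=.
by rewrite sumEFin big_mkord.
Qed.

Section laplace_transform.
Variables (R : realType) (N : nat).
Local Notation Om := 'rV[R]_N.
Local Notation FM := {finite_measure set Om -> \bar R}.
Implicit Types (mu nu rho : FM) (y : 'I_N -> R).

(** The absolute values replace a restriction of the measures to the orthant of nonnegative
    exponents. *)
Definition lap_kernel y (w : Om) : R := expR (- \sum_(i < N) `|w 0 i| * y i).

Definition lap mu y : R := \int[mu]_w lap_kernel y w.

Lemma measurable_lap_kernel y : measurable_fun setT (lap_kernel y).
Proof.
apply: measurableT_comp; first exact: measurable_expR.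
apply: measurableT_comp; first exact: oppr_measurable.
apply: measurable_sum => i; apply: measurable_funM => //.
exact: (measurableT_comp (@normr_measurable R setT) (measurable_coor i)).
Qed.

Lemma lap_kernel_le1 y w : (forall i, 0 <= y i) -> lap_kernel y w <= 1.
Proof.
move=> y0; rewrite -expR0 ler_expR oppr_le0.
by apply: sumr_ge0 => i _; rewrite mulr_ge0.
Qed.

Lemma lapE mu y : (forall i, 0 <= y i) ->
  ((lap mu y)%:E = \int[mu]_w (lap_kernel y w)%:E)%E.
Proof.
move=> y0; rewrite /lap /Rintegral fineK// ge0_fin_numE; last first.
  by apply: integral_ge0 => w _; rewrite lee_fin expR_ge0.
apply: (@le_lt_trans _ _ (\int[mu]_w 1%:E)%E).
  apply: ge0_le_integral => //.
  - by move=> w _; rewrite lee_fin expR_ge0.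
  - by apply/measurable_EFinP; exact: measurable_lap_kernel.
  - by move=> w _; rewrite lee_fin lap_kernel_le1.
by rewrite integral_cst// mul1e -ge0_fin_numE// fin_num_measure.
Qed.

Lemma lap_ge0 mu y : 0 <= lap mu y.
Proof. by apply: Rintegral_ge0 => w _; exact: expR_ge0. Qed.

Lemma lap_mass mu : ((lap mu (fun=> 0%R))%:E = mu setT)%E.
Proof.
have k1 w : lap_kernel (fun=> 0) w = 1.
  by rewrite /lap_kernel big1 ?oppr0 ?expR0// => i _; rewrite mulr0.
by rewrite lapE//; under eq_integral do rewrite k1; rewrite integral_cst// mul1e.
Qed.

Lemma lap_eq mu y (a : R) : (forall i, 0 <= y i) ->
  (\int[mu]_w (lap_kernel y w)%:E = a%:E)%E -> lap mu y = a.
Proof. by move=> y0 H; apply: EFin_inj; rewrite lapE. Qed.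

(** [rho] is the image of the product measure under addition of the exponents |w_i|; the kernel is
    multiplicative for this addition, so Tonelli factors the transform. *)
Lemma exists_conv mu nu : exists rho, forall y, (forall i, 0 <= y i) ->
  lap rho y = lap mu y * lap nu y.
Proof.
pose phi (p : Om * Om) : Om := \row_i (`|p.1 0 i| + `|p.2 0 i|).
have mc i : measurable_fun setT (fun w : Om => `|w 0 i|).
  exact: (measurableT_comp (@normr_measurable R setT) (measurable_coor i)).
have mphi : measurable_fun setT phi.
  apply: measurable_fun_rV => i; under eq_fun do rewrite mxE.
  by apply: measurable_funD; apply: (measurableT_comp (mc i)).
have [||//||rho H] := @weighted_image _ _ _ _ _ (product_measure1 mu nu)
   (fun=> 1) phi.
- exact: measurable_cst.
- by [].
- rewrite integral_cst// mul1e.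
  have /= := product_measure1E mu nu (@measurableT _ Om) (@measurableT _ Om).
  rewrite setXTT => ->.
  by rewrite lte_mul_pinfty// ?fin_num_measure// -ge0_fin_numE// fin_num_measure.
exists rho => y y0; apply: lap_eq => //.
have mk := measurable_lap_kernel y.
rewrite H//; last 2 first.
- exact/measurable_EFinP.
- by move=> w; rewrite lee_fin expR_ge0.
under eq_integral do rewrite mul1e.
transitivity (\int[product_measure1 mu nu]_p
   ((lap_kernel y p.1)%:E * (lap_kernel y p.2)%:E))%E.
  apply: eq_integral => p _; rewrite -EFinM -expRD; congr (expR _)%:E.
  rewrite -opprD -big_split; congr (- _); apply: eq_bigr => i _ /=.
  by rewrite mxE ger0_norm ?addr_ge0// mulrDl.
rewrite fubini_tonelli1//=; last 2 first.
- by apply: emeasurable_funM; apply/measurable_EFinP; apply: (measurableT_comp mk).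
- by move=> p; rewrite -EFinM lee_fin mulr_ge0// expR_ge0.
rewrite /fubini_F/=.
transitivity (\int[mu]_w ((lap nu y)%:E * (lap_kernel y w)%:E))%E.
  apply: eq_integral => w _; rewrite ge0_integralZl//.
  - by rewrite -lapE// muleC.
  - exact/measurable_EFinP.
  - by move=> x _; rewrite lee_fin expR_ge0.
  - by rewrite lee_fin expR_ge0.
rewrite ge0_integralZl//.
- by rewrite -lapE// muleC.
- exact/measurable_EFinP.
- by move=> x _; rewrite lee_fin expR_ge0.
- by rewrite lee_fin lap_ge0.
Qed.

Lemma exists_scale mu (c : R) : 0 <= c ->
  exists rho, forall y, (forall i, 0 <= y i) -> lap rho y = c * lap mu y.
Proof.
move=> c0.
have [||//||rho H] := @weighted_image _ _ _ _ _ mu (fun=> c) (fun w : Om => w).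
- exact: measurable_cst.
- by [].
- by rewrite integral_cst// lte_mul_pinfty// -ge0_fin_numE// fin_num_measure.
exists rho => y y0; apply: lap_eq => //.
have mk := measurable_lap_kernel y.
rewrite H//; last 2 first.
- exact/measurable_EFinP.
- by move=> w; rewrite lee_fin expR_ge0.
rewrite ge0_integralZl//.
- by rewrite -lapE//.
- exact/measurable_EFinP.
- by move=> x _; rewrite lee_fin expR_ge0.
Qed.

Lemma lap_dirac0 y : lap (\d_(0 : Om) : FM) y = 1.
Proof.
rewrite /lap /Rintegral integral_dirac//.
  rewrite diracT mul1e /lap_kernel /= big1 ?oppr0 ?expR0// => i _.
  by rewrite mxE normr0 mul0r.
by apply/measurable_EFinP; exact: measurable_lap_kernel.
Qed.

Lemma exists_pow mu k : exists rho, forall y, (forall i, 0 <= y i) ->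
  lap rho y = lap mu y ^+ k.
Proof.
elim: k => [|k [rho H]].
  by exists (\d_(0 : Om)) => y y0; rewrite lap_dirac0 expr0.
have [rho' H'] := exists_conv mu rho; exists rho' => y y0.
by rewrite H'// H// exprS.
Qed.

Lemma cvg_expR (z : R) : \sum_(k < n) z ^+ k / k`!%:R @[n --> \oo] --> expR z.
Proof.
have := is_cvg_series_exp_coeff z; rewrite /series/= /expR => H.
apply: cvg_trans H; apply: near_eq_cvg; apply: nearW => n /=.
by rewrite big_mkord; apply: eq_bigr => k _.
Qed.

(** The exponential series of convolution powers. Dropping its constant term, for [b = true],
    realises exp - 1 by a positive measure too, which is what the increments of the iteration
    require. *)
Lemma exists_expR mu (b : bool) : exists rho, forall y, (forall i, 0 <= y i) ->
  lap rho y = expR (lap mu y) - b%:R.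
Proof.
pose c k : R := if b && (k == 0)%N then 0 else k`!%:R^-1.
have c0 k : 0 <= c k by rewrite /c; case: ifP => // _; rewrite invr_ge0.
have /choice[p Hp] : forall k, exists rho, forall y, (forall i, 0 <= y i) ->
    lap rho y = c k * lap mu y ^+ k.
  move=> k; have [rho1 H1] := exists_pow mu k.
  have [rho2 H2] := exists_scale rho1 (c0 k).
  by exists rho2 => y y0; rewrite H2// H1.
have cvgc z : (\sum_(k <oo) (c k * z ^+ k)%:E = (expR z - b%:R)%:E)%E.
  apply: nneseries_EFin.
  (* The term of order 0 is split off on both sides: its coefficient is 1 - [b], and the later ones
     do not depend on [b]. *)
  rewrite -(cvg_shiftn 1).
  have H : \sum_(k < n + 1) z ^+ k / k`!%:R - b%:R @[n --> \oo] --> expR z - b%:R.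
    apply: cvgB; last exact: cvg_cst.
    by rewrite (cvg_shiftn 1 (fun n => \sum_(k < n) z ^+ k / k`!%:R)); exact: cvg_expR.
  apply: cvg_trans H; apply: near_eq_cvg; apply: nearW => n /=.
  rewrite addn1 !big_ord_recl /c/= andbT !expr0 fact0 invr1.
  rewrite addrAC; congr (_ + _).
    by case: (b); rewrite /= ?mul0r ?mulr1 ?subrr ?subr0.
  by apply: eq_bigr => k _; rewrite andbF mulrC.
have [|rho H] := measure_sum (mu := p).
  under eq_eseriesr do rewrite -lap_mass Hp//.
  by rewrite cvgc ltry.
exists rho => y y0; apply: lap_eq => //.
rewrite H; last 2 first.
- by apply/measurable_EFinP; exact: measurable_lap_kernel.
- by move=> w; rewrite lee_fin expR_ge0.
by under eq_eseriesr do rewrite -lapE// Hp//.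
Qed.

End laplace_transform.

(** * The convolution equation mu = exp(T mu) *)

Section fixed_point.
Variables (R : realType) (N : nat).
Local Notation Om := 'rV[R]_N.
Local Notation FM := {finite_measure set Om -> \bar R}.

(** Follows from exp(-1/2) >= 1 - 1/2. *)
Lemma expR_half_le2 : expR (2^-1 : R) <= 2.
Proof.
have := @expR_ge1Dx R (- 2^-1); rewrite expRN => H.
have e0 : 0 < expR (2^-1 : R) by exact: expR_gt0.
have := ler_wpM2l (ltW e0) H; rewrite mulfV ?gt_eqF//; lra.
Qed.

(** [h y w] is the transform at [y] of the image under [Top] of a unit mass at [w]; describing [Top]
    by it expresses linearity and countable additivity at once. The scheme is Picard's: [W n.+1] is
    exp of [Top] applied to the sum of [D 0], ..., [D n], and this sum has the transform of [W n].
    Since exp turns sums into products, each increment is the convolution of [W n] with some exp -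
    1, hence positive. *)
Lemma exists_exponential_fixed_point (Top : FM -> FM)
    (h : ('I_N -> R) -> Om -> \bar R) :
  (forall y, (forall i, 0 <= y i) -> measurable_fun setT (h y)) ->
  (forall y w, (0 <= h y w)%E) ->
  (forall y mu, (forall i, 0 <= y i) ->
     (lap (Top mu) y)%:E = (\int[mu]_w h y w)%E) ->
  (forall w, (h (fun=> 0%R) w <= (4^-1)%:E)%E) ->
  exists mu : FM, lap mu (fun=> 0) <= 2 /\
    forall y, (forall i, 0 <= y i) -> lap mu y = expR (lap (Top mu) y).
Proof.
move=> mh h0 hT h4.
have T4 mu : lap (Top mu) (fun=> 0) <= 4^-1 * lap mu (fun=> 0).
  rewrite -lee_fin hT// EFinM lap_mass -integral_cst//.
  apply: ge0_le_integral => //; first exact: mh.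
have /choice[cv cvE] : forall p : FM * FM, exists rho : FM, forall y,
    (forall i, 0 <= y i) -> lap rho y = lap p.1 y * lap p.2 y.
  by move=> p; exact: exists_conv.
have /choice[ex exE] : forall p : FM * bool, exists rho : FM, forall y,
    (forall i, 0 <= y i) -> lap rho y = expR (lap p.1 y) - p.2%:R.
  by move=> p; exact: exists_expR.
(* [W n] will have transform [exp (sum_(k < n) lap (Top (D k)))], and [D n] is
   its increment, a positive measure; their masses stay below 2. *)
pose step (p : FM * FM) : FM * FM :=
  (cv (p.1, ex (Top p.2, false)), cv (p.1, ex (Top p.2, true))).
pose WD n := iter n step (\d_(0 : Om) : FM, \d_(0 : Om) : FM).
pose W n := (WD n).1; pose D n := (WD n).2.
have WS n y : (forall i, 0 <= y i) ->
    lap (W n.+1) y = lap (W n) y * expR (lap (Top (D n)) y).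
  by move=> y0; rewrite /W /WD iterS /= cvE//= exE//= subr0.
have DS n y : (forall i, 0 <= y i) ->
    lap (D n.+1) y = lap (W n) y * (expR (lap (Top (D n)) y) - 1).
  by move=> y0; rewrite /D /WD iterS /= cvE//= exE//=.
have WE n y : (forall i, 0 <= y i) ->
    lap (W n) y = expR (\sum_(k < n) lap (Top (D k)) y).
  move=> y0; elim: n => [|n IH]; first by rewrite big_ord0 expR0 lap_dirac0.
  by rewrite WS// IH big_ord_recr/= expRD.
have DE n y : (forall i, 0 <= y i) ->
    \sum_(k < n.+1) lap (D k) y = lap (W n) y.
  move=> y0; elim: n => [|n IH]; first by rewrite big_ord1 /W /D /= lap_dirac0.
  by rewrite big_ord_recr/= IH DS// WS// mulrBr mulr1 addrC subrK.
(* The bound reproduces itself: [Top] turns mass 2 into mass at most 1/2, and exp(1/2) <= 2. *)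
have W2 n : lap (W n) (fun=> 0) <= 2.
  elim: n => [|n IH]; first by rewrite lap_dirac0; lra.
  rewrite WE// (le_trans _ expR_half_le2)// ler_expR.
  apply: (@le_trans _ _ (\sum_(k < n.+1) 4^-1 * lap (D k) (fun=> 0))).
    by apply: ler_sum => k _.
  by rewrite -mulr_sumr DE//; lra.
have [|mu muE] := @measure_sum _ _ _ D.
  apply: (@le_lt_trans _ _ 2%:E); last by rewrite ltry.
  apply: lime_le.
    by apply: is_cvg_ereal_nneg_natsum => k _.
  apply: nearW => n; under eq_bigr do rewrite -lap_mass.
  rewrite sumEFin lee_fin big_mkord; case: n => [|n]; first by rewrite big_ord0.
  by rewrite DE.
exists mu.
have lapsum y : (forall i, 0 <= y i) ->
    \sum_(k < n) lap (D k) y @[n --> \oo] --> lap mu y.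
  move=> y0; apply: (cvg_nneseriesE (a := fun k => lap (D k) y)); first by move=> k; exact: lap_ge0.
  rewrite lapE// muE; last 2 first.
  - by apply/measurable_EFinP; exact: measurable_lap_kernel.
  - by move=> w; rewrite lee_fin expR_ge0.
  by apply: eq_eseriesr => k _; rewrite lapE.
have lapW y : (forall i, 0 <= y i) -> lap (W n) y @[n --> \oo] --> lap mu y.
  move=> y0; have := lapsum _ y0; rewrite -(cvg_shiftn 1).
  apply: cvg_trans; apply: near_eq_cvg; apply: nearW => n /=.
  by rewrite addn1 DE.
split.
  have H := lapW (fun=> 0) (fun=> lexx 0).
  rewrite -(cvg_lim _ H)//; apply: limr_le; last exact: nearW.
  by apply/cvg_ex; exists (lap mu (fun=> 0)).
move=> y y0.
(* [Top] passes through the infinite sum because its transform is the integral of [h y] against the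
   measure. *)
have TW : \sum_(k < n) lap (Top (D k)) y @[n --> \oo] --> lap (Top mu) y.
  apply: (cvg_nneseriesE (a := fun k => lap (Top (D k)) y)); first by move=> k; exact: lap_ge0.
  rewrite hT// muE//; last exact: mh.
  by apply: eq_eseriesr => k _; rewrite hT.
rewrite -(cvg_lim _ (lapW y y0))//; apply: cvg_lim => //.
under eq_fun do rewrite WE//.
by apply: continuous_cvg => //; exact: continuous_expR.
Qed.

End fixed_point.

(** * Integrals over the half line *)

Section half_line.
Variable R : realType.
Implicit Types f g P : R -> R.

Local Lemma within_of_ge0 f (D : set R) : (D `<=` [set t | 0 <= t]) ->
  (forall t : R, 0 <= t -> {for t, continuous f}) -> {within D, continuous f}.
Proof.
move=> D0 cf; apply: continuous_in_subspaceT => t /set_mem Dt.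
by apply: cf; exact: D0.
Qed.

Lemma half_line_measurable f : (forall t : R, 0 <= t -> {for t, continuous f}) ->
  measurable_fun `[(0%R : R), +oo[ f.
Proof.
move=> cf; apply: subspace_continuous_measurable_fun => //.
by apply: within_of_ge0 cf => t /=; rewrite in_itv/= andbT.
Qed.

(** The fundamental theorem of calculus for P' = f - g, arranged as an equality of nonnegative
    extended reals, so that both integrals are allowed to diverge. *)
Lemma half_line_integral f g P :
  (forall t : R, 0 <= t -> 0 <= f t) -> (forall t : R, 0 <= t -> 0 <= g t) ->
  (forall t : R, 0 <= t -> {for t, continuous f}) ->
  (forall t : R, 0 <= t -> {for t, continuous g}) ->
  (forall t : R, 0 <= t -> is_derive t 1 P (f t - g t)) ->
  P n%:R @[n --> \oo] --> 0 ->
  (\int[lebesgue_measure]_(t in `[(0%R : R), +oo[) (g t)%:E =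
   \int[lebesgue_measure]_(t in `[(0%R : R), +oo[) (f t)%:E + (P 0%R)%:E)%E.
Proof.
move=> f0 g0 cf cg dP P0.
pose F n := `[0 : R, n.+1%:R]%classic.
have F0 n : F n `<=` [set t | 0 <= t] by move=> t; rewrite /F /= in_itv/= => /andP[].
have FU : \bigcup_n F n = `[(0%R : R), +oo[%classic.
  apply/seteqP; split => t /=.
    by move=> [n _]; rewrite /F /= !in_itv/= andbT => /andP[].
  rewrite in_itv/= andbT => t0; exists (Num.trunc t) => //; rewrite /F /=.
  by rewrite in_itv/= t0/= ltW// truncnS_gt.
have ndF : nondecreasing_seq F.
  move=> m n mn; apply/subsetPset => t; rewrite /F /= !in_itv/= => /andP[-> /=] tm.
  by rewrite (le_trans tm)// ler_nat ltnS.
have cvgI (h : R -> R) : (forall t : R, 0 <= t -> 0 <= h t) ->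
    (forall t : R, 0 <= t -> {for t, continuous h}) ->
    (\int[lebesgue_measure]_(t in F n) (h t)%:E @[n --> \oo] -->
     \int[lebesgue_measure]_(t in `[(0%R : R), +oo[) (h t)%:E)%E.
  move=> h0 ch; rewrite -FU; apply: ge0_nondecreasing_set_cvg_integral => //.
  - by move=> n; exact: measurable_itv.
  - move=> n; apply/measurable_EFinP; apply: subspace_continuous_measurable_fun => //.
      exact: measurable_itv.
    exact: (within_of_ge0 (F0 n)).
  - by move=> n t /F0 t0; rewrite lee_fin h0.
have Icpt (h : R -> R) n : (forall t : R, 0 <= t -> {for t, continuous h}) ->
    (@lebesgue_measure R).-integrable (F n) (EFin \o h).
  move=> ch; apply: continuous_compact_integrable; first exact: segment_compact.
  exact: (within_of_ge0 (F0 n)).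
have step n : (\int[lebesgue_measure]_(t in F n) (g t)%:E =
    \int[lebesgue_measure]_(t in F n) (f t)%:E + (P 0%R - P n.+1%:R)%:E)%E.
  have cP t : 0 <= t -> {for t, continuous P}.
    by move=> /dP dPt; apply/differentiable_continuous/derivable1_diffP.
  have E : (\int[lebesgue_measure]_(t in F n) (f t - g t)%:E =
      (P n.+1%:R)%:E - (P 0%R)%:E)%E.
    apply: continuous_FTC2 => //.
    - apply: within_of_ge0 (F0 n) _ => t t0.
      by apply: continuousB; [exact: cf|exact: cg].
    - split.
      + move=> t; rewrite in_itv/= => /andP[/ltW /dP dPt _]; exact: ex_derive.
      + by apply: cvg_at_right_filter; exact: cP.
      + by apply: cvg_at_left_filter; exact: cP.
    - move=> t; rewrite in_itv/= => /andP[/ltW /dP dPt _].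
      by rewrite derive1E; exact: derive_val.
  have mF : measurable (F n) by exact: measurable_itv.
  rewrite integralB_EFin// in E; [|exact: Icpt|exact: Icpt].
  have : (\int[lebesgue_measure]_(t in F n) (f t)%:E)%E \is a fin_num.
    by apply: integrable_fin_num; [exact: measurable_itv|exact: Icpt].
  have : (\int[lebesgue_measure]_(t in F n) (g t)%:E)%E \is a fin_num.
    by apply: integrable_fin_num; [exact: measurable_itv|exact: Icpt].
  rewrite /comp; move: E; move: (\int[_]_(_ in _) (f _)%:E)%E (\int[_]_(_ in _) (g _)%:E)%E.
  move=> [a| |] // [b| |] // [E] _ _; congr EFin; rewrite -opprB -E; ring.
have := cvgI _ g0 cg; under eq_fun do rewrite step.
move=> /cvg_lim <- //; apply: cvg_lim => //; apply: cvgeD => //.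
- by rewrite fin_num_adde_defl.
- exact: cvgI.
- apply: cvg_EFin; first exact: nearW.
  rewrite -[X in _ --> X]subr0; apply: cvgB; first exact: cvg_cst.
  by rewrite -(cvg_shiftn 1) in P0; under eq_fun do rewrite -addn1.
Qed.

End half_line.

(** * The heat flow of a Gaussian *)

Section heat_decay.
Variable R : realType.
Implicit Types b t z c : R.

Lemma is_derive1_eq (f : R -> R) (x d d' : R) :
  is_derive x 1 f d -> d = d' -> is_derive x 1 f d'.
Proof. by move=> H <-. Qed.

(* The heat flow of [exp (- b x^2)] at time [t] is
   [(1 + 4 b t)^(-1/2) exp (- beta b t * x^2)]. *)
Definition spread b t : R := ln (1 + 4 * b * t).
Definition beta b t : R := b * expR (- spread b t).

Lemma spread_arg_ge1 b t : 0 <= b -> 0 <= t -> 1 <= 1 + 4 * b * t.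
Proof. by move=> b0 t0; rewrite lerDl !mulr_ge0. Qed.

Lemma spread_ge0 b t : 0 <= b -> 0 <= t -> 0 <= spread b t.
Proof. by move=> b0 t0; apply: ln_ge0; exact: spread_arg_ge1. Qed.

Lemma spreadK b t : 0 <= b -> 0 <= t -> expR (spread b t) = 1 + 4 * b * t.
Proof.
by move=> b0 t0; rewrite lnK// posrE (lt_le_trans ltr01)// spread_arg_ge1.
Qed.

Lemma spread0 b : spread b 0 = 0.
Proof. by rewrite /spread mulr0 addr0 ln1. Qed.

Lemma ler_spread a b t : 0 <= a -> a <= b -> 0 <= t -> spread a t <= spread b t.
Proof.
move=> a0 ab t0; rewrite -ler_expR !spreadK//; last exact: le_trans ab.
by rewrite lerD2l ler_wpM2r// ler_wpM2l.
Qed.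

Lemma beta0 b : beta b 0 = b.
Proof. by rewrite /beta spread0 oppr0 expR0 mulr1. Qed.

Lemma beta_ge0 b t : 0 <= b -> 0 <= beta b t.
Proof. by move=> b0; rewrite mulr_ge0// expR_ge0. Qed.

Lemma beta_le b t : 0 <= b -> 0 <= t -> beta b t <= b.
Proof.
move=> b0 t0; rewrite ler_piMr// -expR0 ler_expR oppr_le0.
exact: spread_ge0.
Qed.

(** For b > 0 the reciprocal of [beta b t] is 1 / b + 4 t; cross-multiplication covers a = 0 as
    well. *)
Lemma ler_beta a b t : 0 <= a -> a <= b -> 0 <= t -> beta a t <= beta b t.
Proof.
move=> a0 ab t0; have b0 := le_trans a0 ab.
rewrite /beta !expRN !spreadK//.
rewrite ler_pdivrMr ?(lt_le_trans ltr01) ?spread_arg_ge1//.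
rewrite mulrAC ler_pdivlMr ?(lt_le_trans ltr01) ?spread_arg_ge1//.
by rewrite !mulrDr !mulr1 lerD// le_eqVlt; apply/orP; left; apply/eqP; ring.
Qed.

Lemma is_derive_spread b t : 0 <= b -> 0 <= t ->
  is_derive t 1 (spread b) (4 * beta b t).
Proof.
move=> b0 t0; have q0 := lt_le_trans ltr01 (spread_arg_ge1 b0 t0).
have H2 : is_derive t 1 (fun t => 1 + 4 * b * t) (4 * b).
  by apply: is_derive_eq; rewrite /GRing.scale /=; ring.
have H3 := @is_derive1_comp _ _ (fun t => 1 + 4 * b * t) t _ _ (is_derive1_ln q0) H2.
apply: (is_derive1_eq H3); rewrite /beta expRN spreadK//; ring.
Qed.

(** The Riccati equation of the exponent of a Gaussian under the heat flow. *)
Lemma is_derive_beta b t : 0 <= b -> 0 <= t ->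
  is_derive t 1 (beta b) (- (4 * beta b t ^+ 2)).
Proof.
move=> b0 t0; have H := is_derive_spread b0 t0.
have H2 : is_derive t 1 (fun t => - spread b t) (- (4 * beta b t)).
  exact: is_deriveN.
have H3 := @is_derive1_comp _ _ (fun t => - spread b t) t _ _ (is_derive_expR (- spread b t)) H2.
have H4 := is_deriveZ b H3.
apply: (is_derive1_eq H4); rewrite /beta /= /GRing.scale /=; ring.
Qed.

Lemma continuous_spread b t : 0 <= b -> 0 <= t -> {for t, continuous (spread b)}.
Proof.
move=> b0 t0; apply/differentiable_continuous/derivable1_diffP.
have H := is_derive_spread b0 t0; exact: ex_derive.
Qed.

Lemma continuous_beta b t : 0 <= b -> 0 <= t -> {for t, continuous (beta b)}.
Proof.
move=> b0 t0; apply/differentiable_continuous/derivable1_diffP.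
have H := is_derive_beta b0 t0; exact: ex_derive.
Qed.

(** The function is the power (1 + 4 b t)^(-c); writing it through [spread] gives real exponents and
    turns products of powers into sums. *)
Lemma is_derive_expR_spread b c t : 0 <= b -> 0 <= t ->
  is_derive t 1 (fun t => expR (- (c * spread b t)))
    (- (4 * c * b * expR (- ((c + 1) * spread b t)))).
Proof.
move=> b0 t0; have H := is_derive_spread b0 t0.
have H2 : is_derive t 1 (fun t => - (c * spread b t)) (- (c * (4 * beta b t))).
  by apply: is_deriveN; exact: is_deriveZ.
have H3 := @is_derive1_comp _ _ (fun t => - (c * spread b t)) t _ _
  (is_derive_expR (- (c * spread b t))) H2.
apply: (is_derive1_eq H3); rewrite /beta.
rewrite (_ : - ((c + 1) * spread b t) = - (c * spread b t) + - spread b t); last by ring.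
rewrite expRD; ring.
Qed.


Lemma cvg_expR_spread b c : 0 < b -> 0 < c ->
  expR (- (c * spread b n%:R)) @[n --> \oo] --> 0.
Proof.
move=> b0 c0; apply: (@cvg_comp _ _ _ (fun n => c * spread b n%:R) (fun x => expR (- x))
  _ _ _ _ (@cvgr_expR R)).
apply/cvgryPge => A; near=> n.
rewrite -ler_pdivrMl// -ler_expR spreadK ?ler0n ?ltW//.
have : expR (c^-1 * A) / (4 * b) <= n%:R by near: n; exact: nbhs_infty_ger.
rewrite ler_pdivrMr ?mulr_gt0// => H; apply: (le_lt_trans H).
by rewrite mulrC ltrDr.
Unshelve. all: by end_near. Qed.

Lemma half_line_integral_expR b c : 0 < b -> 0 < c ->
  (\int[lebesgue_measure]_(t in `[(0%R : R), +oo[)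
     (expR (- ((c + 1) * spread b t)))%:E = ((4 * b * c)^-1)%:E)%E.
Proof.
move=> b_gt0 c0; have b0 := ltW b_gt0.
have ce (t : R) : 0 <= t -> {for t, continuous (fun t => expR (- ((c + 1) * spread b t)))}.
  move=> t0; have H := is_derive_expR_spread (c + 1) b0 t0.
  by apply/differentiable_continuous/derivable1_diffP; exact: ex_derive.
refine (etrans (@half_line_integral _ (fun=> 0) _
   (fun t => (4 * b * c)^-1 * expR (- (c * spread b t))) _ _ _ _ _ _) _).
- by [].
- by move=> t _; exact: expR_ge0.
- by move=> t _; exact: cvg_cst.
- exact: ce.
- move=> t t0; have H := is_deriveZ (4 * b * c)^-1 (is_derive_expR_spread c b0 t0).
  apply: (is_derive1_eq H); rewrite /GRing.scale /=; field; rewrite ?gt_eqF//.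
- rewrite -[X in _ --> X](mulr0 (4 * b * c)^-1); apply: cvgM; first exact: cvg_cst.
  by apply: cvg_expR_spread; lra.
- by rewrite integral0 add0e spread0 mulr0 oppr0 expR0 mulr1.
Qed.

End heat_decay.

(** * Potentials of the heat flow as maps on measures *)

Section heat_potential.
Variables (R : realType) (N : nat) (al : 'I_N -> R) (l : R).
Local Notation Om := 'rV[R]_N.
Local Notation FM := {finite_measure set Om -> \bar R}.
Implicit Types (t : R) (w : Om) (k : bool).
Hypothesis hN : (5 <= N)%N.
Hypothesis hal : forall i, 7 / 2 <= al i.
Hypothesis l0 : 0 <= l.
Hypothesis hl : expR (l * \sum_(i < N) al i) <= 2.

(** Multiplying the Gaussian of exponents |w_i| by exp(- p) shifts the exponents by [al]. *)
Definition rate (w : Om) (i : 'I_N) : R := al i + `|w 0 i|.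

(** Minus the logarithm of the amplitude of the flow, the product over i of (1 + 4 [rate w i]
    t)^(-1/2). *)
Definition half_spread (w : Om) t : R := \sum_(i < N) spread (rate w i) t / 2.

Definition flow_point (p : Om * measurableTypeR R) : Om := \row_i beta (rate p.1 i) p.2.

(* The factor [exp (l (beta - |w|))] converts between densities with respect to
   the weights [exp (- l |w|)] before and after the flow. *)
Definition flow_weight (k : bool) (w : Om) (t : R) : R :=
  t ^+ k * expR (- half_spread w t + l * \sum_(i < N) (beta (rate w i) t - `|w 0 i|)).

Lemma rate_ge w i : 7 / 2 <= rate w i.
Proof. by rewrite (le_trans (hal i))// lerDl. Qed.

Lemma rate_ge0 w i : 0 <= rate w i.
Proof. by apply: le_trans (rate_ge w i); lra. Qed.

Lemma half_spread_ge_dim w t : 0 <= t -> N%:R / 2 * spread (7 / 2) t <= half_spread w t.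
Proof.
move=> t0; apply: (@le_trans _ _ (\sum_(i < N) spread (7 / 2) t / 2)).
  by rewrite sumr_const card_ord -[leRHS]mulr_natl mulrAC mulrA.
apply: ler_sum => i _; rewrite ler_wpM2r//; apply: ler_spread => //.
exact: rate_ge.
Qed.

Lemma half_spread_ge w t : 0 <= t -> 5 / 2 * spread (7 / 2) t <= half_spread w t.
Proof.
move=> t0; apply: (le_trans _ (half_spread_ge_dim w t0)).
have s0 : 0 <= spread (7 / 2) t by apply: spread_ge0 => //; lra.
by rewrite ler_wpM2r// ler_wpM2r// (ler_nat _ 5).
Qed.

Lemma flow_weight_ge0 k w t : 0 <= t -> 0 <= flow_weight k w t.
Proof. by move=> t0; rewrite mulr_ge0 ?exprn_ge0 ?expR_ge0. Qed.

(** With 14 = 4 * 7/2, the left factor is (1 + 14 t)^(-5/2). One power of 1 + 14 t absorbs t, at the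
    price 1/14, and the remaining 3/2 exceeds 1, which leaves an integrable function. *)
Lemma pow_expR_spread_le (k : bool) t : 0 <= t ->
  t ^+ k * expR (- (5 / 2 * spread (7 / 2) t)) <=
  (14 ^+ k)^-1 * expR (- ((1 / 2 + 1) * spread (7 / 2) t)).
Proof.
move=> t0; have b0 : 0 <= 7 / 2 :> R by lra.
rewrite (_ : - ((1 / 2 + 1) * _) =
   - (5 / 2 * spread (7 / 2) t) + spread (7 / 2) t); last by field.
rewrite expRD spreadK// mulrCA [leLHS]mulrC ler_wpM2l ?expR_ge0//.
have := spread_arg_ge1 b0 t0.
case: k => /=; rewrite ?expr1 ?expr0 => H; last by rewrite invr1 mul1r.
by rewrite ler_pdivlMl//; lra.
Qed.

(** Uniform in [w]: since [beta] is at most the rate [al i] + |w_i|, the conversion of weights costs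
    at most exp(l sum_i [al i]) <= 2. *)
Lemma flow_weight_le k w t : 0 <= t ->
  flow_weight k w t <=
  2 * ((14 ^+ k)^-1 * expR (- ((1 / 2 + 1) * spread (7 / 2) t))).
Proof.
move=> t0; apply: (@le_trans _ _ (2 * (t ^+ k * expR (- (5 / 2 * spread (7 / 2) t))))).
  rewrite /flow_weight mulrCA ler_wpM2l ?exprn_ge0// expRD mulrC.
  rewrite ler_pM ?expR_ge0//; last by rewrite ler_expR lerN2 half_spread_ge.
  apply: le_trans hl; rewrite ler_expR ler_wpM2l//; apply: ler_sum => i _.
  by rewrite lerBlDr beta_le ?rate_ge0.
by rewrite ler_pM2l// pow_expR_spread_le.
Qed.

Lemma measurable_rate i : measurable_fun setT (rate ^~ i).
Proof.
apply: measurable_funD => //.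
exact: (measurableT_comp (@normr_measurable R setT) (measurable_coor i)).
Qed.

Local Notation X := (Om * measurableTypeR R)%type.

Lemma measurable_flow_spread i :
  measurable_fun setT (fun p : X => spread (rate p.1 i) p.2).
Proof.
apply: measurableT_comp; first exact: measurable_ln.
apply: measurable_funD => //; apply: measurable_funM; last exact: measurable_snd.
by apply: measurable_funM => //; apply: (measurableT_comp (measurable_rate i)).
Qed.

Lemma measurable_flow_beta i :
  measurable_fun setT (fun p : X => beta (rate p.1 i) p.2).
Proof.
apply: measurable_funM; first exact: (measurableT_comp (measurable_rate i)).
apply: measurableT_comp; first exact: measurable_expR.
apply: measurableT_comp; first exact: oppr_measurable.
exact: measurable_flow_spread.
Qed.

Lemma measurable_flow_point : measurable_fun setT flow_point.
Proof.
apply: measurable_fun_rV => i; under eq_fun do rewrite mxE.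
exact: measurable_flow_beta.
Qed.

Lemma measurable_flow_weight k :
  measurable_fun setT (fun p : X => flow_weight k p.1 p.2).
Proof.
apply: measurable_funM.
  by apply: measurable_funX; exact: measurable_snd.
apply: measurableT_comp; first exact: measurable_expR.
apply: measurable_funD.
  apply: measurableT_comp; first exact: oppr_measurable.
  apply: measurable_sum => i; apply: measurable_funM => //.
  exact: measurable_flow_spread.
apply: measurable_funM => //.
apply: measurable_sum => i; apply: measurable_funB.
  exact: measurable_flow_beta.
apply: (measurableT_comp (@normr_measurable R setT)).
by apply: (measurableT_comp (measurable_coor i)).
Qed.

Let itv0y := `[(0%R : R), +oo[%classic : set (measurableTypeR R).
Let leb := (@lebesgue_measure R).

(** The adjoint action of the flow on functions of the exponents. [k = true] brings the factor t of
    Delta^-2; [k = false] gives (- Delta)^-1, through which the bilaplacian is computed in two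
    steps. *)
Definition flow_integral (k : bool) (g : Om -> \bar R) (w : Om) : \bar R :=
  (\int[leb]_(t in itv0y) ((flow_weight k w t)%:E * g (flow_point (w, t))))%E.

Let cut_weight k (p : X) : R := flow_weight k p.1 p.2 * \1_itv0y p.2.

Let cut_weight_ge0 k p : 0 <= cut_weight k p.
Proof.
rewrite /cut_weight indicE; case: (boolP (p.2 \in itv0y)) => [|_].
  rewrite inE /itv0y/= in_itv/= andbT => t0.
  by rewrite mulr1 flow_weight_ge0.
by rewrite mulr0.
Qed.

Let measurable_cut_weight k : measurable_fun setT (cut_weight k).
Proof.
apply: measurable_funM; first exact: measurable_flow_weight.
apply: (measurableT_comp (f := (\1_itv0y : measurableTypeR R -> R))); last exact: measurable_snd.
by apply: measurable_indic; exact: measurable_itv.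
Qed.

Let flow_integrand_measurable k (g : Om -> \bar R) : measurable_fun setT g ->
  measurable_fun setT (fun p : X => (cut_weight k p)%:E * g (flow_point p))%E.
Proof.
move=> mg; apply: emeasurable_funM; first exact/measurable_EFinP.
exact: (measurableT_comp mg measurable_flow_point).
Qed.

Let flow_integralE k g w : flow_integral k g w =
  (\int[leb]_t ((cut_weight k (w, t))%:E * g (flow_point (w, t))))%E.
Proof.
rewrite /flow_integral integral_mkcond; apply: eq_integral => t _.
rewrite patchE /cut_weight indicE /=; case: ifPn => _; first by rewrite mulr1.
by rewrite mulr0 mul0e.
Qed.

Lemma flow_integral_ge0 k g w : (forall x, 0 <= g x)%E -> (0 <= flow_integral k g w)%E.
Proof.
move=> g0; rewrite flow_integralE; apply: integral_ge0 => t _.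
by rewrite mule_ge0// lee_fin cut_weight_ge0.
Qed.

Lemma measurable_flow_integral k g : measurable_fun setT g ->
  (forall x, 0 <= g x)%E -> measurable_fun setT (flow_integral k g).
Proof.
move=> mg g0; rewrite (_ : flow_integral k g = fubini_F leb
   (fun p : X => (cut_weight k p)%:E * g (flow_point p))%E).
  apply: measurable_fun_fubini_tonelli_F; first exact: flow_integrand_measurable.
  by move=> p; rewrite mule_ge0// lee_fin cut_weight_ge0.
by apply/funext => w; rewrite flow_integralE.
Qed.

Lemma measurable_flow_weight_snd k w : measurable_fun setT (flow_weight k w).
Proof.
apply: (measurableT_comp (measurable_flow_weight k) (g := fun t : measurableTypeR R => (w, t))).
by apply: measurable_fun_pair => //; exact: measurable_cst.
Qed.

Lemma measurable_spread (b : R) : measurable_fun setT (spread b).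
Proof.
apply: measurableT_comp; first exact: measurable_ln.
by apply: measurable_funD => //; exact: measurable_funM.
Qed.

(** Here 1/7 is the integral of (1 + 14 t)^(-3/2) over the half line and 2 is the cost of the
    weights. For [k = true] the bound is 1/49. *)
Lemma flow_integral_cst_le k w : (flow_integral k (fun=> 1%E) w <= (2 / 7 / 14 ^+ k)%:E)%E.
Proof.
have mE : measurable_fun itv0y
    (fun t : measurableTypeR R => (expR (- ((1 / 2 + 1) * spread (7 / 2) t)))%:E).
  apply/measurable_EFinP; apply: measurable_funTS.
  apply: measurableT_comp; first exact: measurable_expR.
  apply: measurableT_comp; first exact: oppr_measurable.
  by apply: measurable_funM => //; exact: measurable_spread.
rewrite /flow_integral; under eq_integral do rewrite mule1.
apply: (@le_trans _ _ (\int[leb]_(t in itv0y)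
   ((2 / 14 ^+ k)%:E * (expR (- ((1 / 2 + 1) * spread (7 / 2) t)))%:E))%E).
  apply: ge0_le_integral => //.
  - exact: measurable_itv.
  - move=> t; rewrite /itv0y /= in_itv/= andbT => t0.
    by rewrite lee_fin flow_weight_ge0.
  - by apply/measurable_EFinP; apply: measurable_funTS; exact: measurable_flow_weight_snd.
  - by apply: emeasurable_funM.
  - move=> t; rewrite /itv0y /= in_itv/= andbT => t0.
    by rewrite -EFinM lee_fin (le_trans (flow_weight_le _ _ t0))// mulrA.
rewrite ge0_integralZl//.
- by rewrite half_line_integral_expR -?EFinM ?lee_fin; [case: k; rewrite ?expr1 ?expr0|..]; lra.
- exact: measurable_itv.
Qed.

Lemma exists_flow_measure k (mu : FM) : exists rho : FM,
  forall g : Om -> \bar R, measurable_fun setT g -> (forall x, 0 <= g x)%E ->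
    (\int[rho]_w g w = \int[mu]_w flow_integral k g w)%E.
Proof.
have H1 g : measurable_fun setT g -> (forall x, 0 <= g x)%E ->
    (\int[mu \x leb]_p ((cut_weight k p)%:E * g (flow_point p)) =
     \int[mu]_w flow_integral k g w)%E.
  move=> mg g0; rewrite fubini_tonelli1.
  - by apply: eq_integral => w _; rewrite flow_integralE.
  - exact: flow_integrand_measurable.
  - by move=> p; rewrite mule_ge0// lee_fin cut_weight_ge0.
have [||||rho H] := @weighted_image _ _ _ _ _ (mu \x leb)%E (cut_weight k) flow_point.
- exact: measurable_cut_weight.
- exact: cut_weight_ge0.
- exact: measurable_flow_point.
- rewrite [ltLHS](_ : _ = \int[mu]_w flow_integral k (fun=> 1%E) w)%E; last first.
    by rewrite -H1//; apply: eq_integral => p _; rewrite mule1.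
  apply: (@le_lt_trans _ _ (\int[mu]_w (2 / 7 / 14 ^+ k)%:E)%E).
    apply: ge0_le_integral => //.
    + by move=> w _; exact: flow_integral_ge0.
    + exact: measurable_flow_integral.
    + by move=> w _; exact: flow_integral_cst_le.
  by rewrite integral_cst// lte_mul_pinfty// -ge0_fin_numE// fin_num_measure.
by exists rho => g mg g0; rewrite H// H1.
Qed.

End heat_potential.

(** * Polynomial multiples of a Gaussian *)

Section expressions.
Variables (R : realType) (N : nat) (x0 : 'rV[R]_N).
Implicit Types (b : 'I_N -> R) (x : 'rV[R]_N) (i : 'I_N).

(* Derivatives of a Gaussian with respect to [x], as expressions in the rates
   and in [x], so that estimates go by structural induction. *)
Inductive gexp : Type :=
| Cst of R | Rate of 'I_N | Coord of 'I_N | Gauss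
| Add of gexp & gexp | Mul of gexp & gexp.

Definition quad b x : R := \sum_(i < N) b i * (x 0 i - x0 0 i) ^+ 2.

Fixpoint eval (q : gexp) b x : R :=
  match q with
  | Cst c => c
  | Rate i => b i
  | Coord i => x 0 i - x0 0 i
  | Gauss => expR (- quad b x)
  | Add q1 q2 => eval q1 b x + eval q2 b x
  | Mul q1 q2 => eval q1 b x * eval q2 b x
  end.

Fixpoint deriv i (q : gexp) : gexp :=
  match q with
  | Cst _ | Rate _ => Cst 0
  | Coord j => Cst (i == j)%:R
  | Gauss => Mul (Mul (Cst (- 2)) (Mul (Rate i) (Coord i))) Gauss
  | Add q1 q2 => Add (deriv i q1) (deriv i q2)
  | Mul q1 q2 => Add (Mul (deriv i q1) q2) (Mul q1 (deriv i q2))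
  end.

Definition rsum b : R := \sum_(i < N) b i.

Lemma rsum_ge0 b : (forall i, 0 <= b i) -> 0 <= rsum b.
Proof. by move=> b0; apply: sumr_ge0. Qed.

Lemma le_rsum b i : (forall i, 0 <= b i) -> b i <= rsum b.
Proof. by move=> b0; rewrite /rsum (bigD1 i)//= lerDl sumr_ge0. Qed.

Lemma quad_ge0 b x : (forall i, 0 <= b i) -> 0 <= quad b x.
Proof. by move=> b0; apply: sumr_ge0 => i _; rewrite mulr_ge0 ?sqr_ge0. Qed.

Lemma rsum_le_expR b (e : R) : (forall i, 0 <= b i) -> 0 < e ->
  rsum b <= e^-1 * expR (e * rsum b).
Proof.
move=> b0 e0; rewrite ler_pdivlMl// (le_trans _ (expR_ge1Dx _))//.
by rewrite lerDr.
Qed.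

Lemma expR_ge1_rsum b (e : R) : (forall i, 0 <= b i) -> 0 < e -> 1 <= expR (e * rsum b).
Proof. by move=> b0 e0; rewrite -expR0 ler_expR mulr_ge0 ?rsum_ge0// ltW. Qed.

Lemma expR_half_rsum b (e : R) :
  expR (e / 2 * rsum b) * expR (e / 2 * rsum b) = expR (e * rsum b).
Proof. by rewrite -expRD; congr expR; field. Qed.

Lemma expRN_lipschitz (z z' : R) : 0 <= z -> 0 <= z' ->
  `|expR (- z) - expR (- z')| <= `|z - z'|.
Proof.
wlog zz' : z z' / z <= z'.
  move=> H z0 z0'; have [zz'|/ltW zz'] := leP z z'; first exact: H.
  by rewrite distrC [leRHS]distrC; exact: H.
move=> z0 z0'; rewrite ger0_norm ?subr_ge0 ?ler_expR ?lerN2//.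
rewrite distrC ger0_norm ?subr_ge0//.
have H := expR_ge1Dx (z - z').
have E : expR (- z') = expR (- z) * expR (z - z') by rewrite -expRD; congr expR; ring.
have e1 : expR (- z) <= 1 by rewrite -expR0 ler_expR oppr_le0.
have e0 : 0 < expR (- z) by exact: expR_gt0.
rewrite E; nra.
Qed.

(** By convexity the tangent at z makes the remainder nonnegative, and the tangent at z' bounds it
    by a product of two increments, each at most |z' - z| in absolute value. *)
Lemma expRN_taylor (z z' : R) : 0 <= z -> 0 <= z' ->
  `|expR (- z') - expR (- z) + (z' - z) * expR (- z)| <= (z' - z) ^+ 2.
Proof.
move=> z0 z0'.
have H1 := expR_ge1Dx (z - z').
have H2 := expR_ge1Dx (z' - z).
have E1 : expR (- z') = expR (- z) * expR (z - z') by rewrite -expRD; congr expR; ring.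
have E2 : expR (- z) = expR (- z') * expR (z' - z) by rewrite -expRD; congr expR; ring.
have L := expRN_lipschitz z0 z0'.
have e0 : 0 < expR (- z) by exact: expR_gt0.
have e0' : 0 < expR (- z') by exact: expR_gt0.
rewrite ger0_norm; last by rewrite E1; nra.
apply: (@le_trans _ _ ((z' - z) * (expR (- z) - expR (- z')))).
  by rewrite {1}E2; nra.
apply: (le_trans (ler_norm _)); rewrite normrM expr2.
rewrite -[leRHS]ger0_norm -?expr2 ?sqr_ge0// expr2 normrM ler_wpM2l//.
by rewrite (distrC z').
Qed.

Local Notation near_x0 M x := (forall i, `|x 0 i - x0 0 i| <= M).

Lemma eval_bounded q (e M : R) : 0 < e -> exists2 C : R, 0 <= C &
  forall b x, (forall i, 0 <= b i) -> near_x0 M x ->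
    `|eval q b x| <= C * expR (e * rsum b).
Proof.
elim: q e => [c|i|i| |q1 IH1 q2 IH2|q1 IH1 q2 IH2] e e0 /=.
- exists `|c| => // b x b0 _; rewrite ler_peMr//.
  exact: expR_ge1_rsum.
- exists e^-1 => [|b x b0 _]; first by rewrite invr_ge0 ltW.
  by rewrite ger0_norm// (le_trans (le_rsum i b0))// rsum_le_expR.
- exists `|M| => // b x b0 xM; rewrite (le_trans (xM i))//.
  rewrite (le_trans (ler_norm M))// ler_peMr//; exact: expR_ge1_rsum.
- exists 1 => // b x b0 _; rewrite ger0_norm ?expR_ge0// mul1r.
  rewrite (@le_trans _ _ 1)//; last exact: expR_ge1_rsum.
  by rewrite -expR0 ler_expR oppr_le0 quad_ge0.
- have [C1 C10 H1] := IH1 e e0; have [C2 C20 H2] := IH2 e e0.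
  exists (C1 + C2) => [|b x b0 xM]; first by rewrite addr_ge0.
  by rewrite mulrDl (le_trans (ler_normD _ _))// lerD ?H1 ?H2.
- have e20 : 0 < e / 2 by lra.
  have [C1 C10 H1] := IH1 _ e20; have [C2 C20 H2] := IH2 _ e20.
  exists (C1 * C2) => [|b x b0 xM]; first by rewrite mulr_ge0.
  by rewrite normrM -expR_half_rsum mulrACA ler_pM// ?H1 ?H2.
Qed.

Lemma quad_lipschitz b x x' (M D : R) : (forall i, 0 <= b i) ->
  near_x0 M x -> near_x0 M x' -> (forall i, `|x' 0 i - x 0 i| <= D) ->
  `|quad b x' - quad b x| <= rsum b * (2 * M * D).
Proof.
move=> b0 xM xM' xD; rewrite /quad /rsum -sumrB mulr_suml.
rewrite (le_trans (ler_norm_sum _ _ _))//; apply: ler_sum => i _.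
rewrite -mulrBr normrM ger0_norm// ler_wpM2l//.
rewrite subr_sqr normrM mulrC ler_pM//.
  rewrite (le_trans (ler_normD _ _))// (_ : 2 * M = M + M); last by ring.
  by rewrite lerD.
by rewrite (_ : _ - _ = x' 0 i - x 0 i)//; ring.
Qed.

Lemma eval_lipschitz q (e M : R) : 0 < e -> exists2 C : R, 0 <= C &
  forall b x x' D, (forall i, 0 <= b i) -> near_x0 M x -> near_x0 M x' ->
    (forall i, `|x' 0 i - x 0 i| <= D) -> 0 <= D ->
    `|eval q b x' - eval q b x| <= C * expR (e * rsum b) * D.
Proof.
elim: q e => [c|i|i| |q1 IH1 q2 IH2|q1 IH1 q2 IH2] e e0 /=.
- by exists 0 => // b x x' D b0 _ _ _ D0; rewrite subrr normr0 !mul0r.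
- by exists 0 => // b x x' D b0 _ _ _ D0; rewrite subrr normr0 !mul0r.
- exists 1 => // b x x' D b0 _ _ xD D0.
  rewrite mul1r (_ : _ - _ = x' 0 i - x 0 i); last by ring.
  by rewrite (le_trans (xD i))// ler_peMl// expR_ge1_rsum.
- exists (2 * `|M| / e) => [|b x x' D b0 xM xM' xD D0].
    by rewrite !mulr_ge0// invr_ge0 ltW.
  rewrite (le_trans (expRN_lipschitz _ _)) ?quad_ge0//.
  have xN (z : 'rV[R]_N) : near_x0 M z -> near_x0 `|M| z.
    by move=> H i; rewrite (le_trans (H i))// ler_norm.
  rewrite (le_trans (quad_lipschitz b0 (xN _ xM) (xN _ xM') xD))//.
  rewrite (_ : 2 * `|M| / e * _ * D =
    e^-1 * expR (e * rsum b) * (2 * `|M| * D)); last by ring.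
  by rewrite ler_wpM2r ?mulr_ge0// rsum_le_expR.
- have [C1 C10 H1] := IH1 e e0; have [C2 C20 H2] := IH2 e e0.
  exists (C1 + C2) => [|b x x' D b0 xM xM' xD D0]; first by rewrite addr_ge0.
  rewrite opprD addrACA mulrDl mulrDl (le_trans (ler_normD _ _))//.
  by rewrite lerD ?H1 ?H2.
- have e20 : 0 < e / 2 by lra.
  have [C1 C10 H1] := IH1 _ e20; have [C2 C20 H2] := IH2 _ e20.
  have [B1 B10 K1] := eval_bounded q1 M e20; have [B2 B20 K2] := eval_bounded q2 M e20.
  exists (C1 * B2 + B1 * C2) => [|b x x' D b0 xM xM' xD D0].
    by rewrite addr_ge0 ?mulr_ge0.
  rewrite (_ : _ - _ = (eval q1 b x' - eval q1 b x) * eval q2 b x' +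
      eval q1 b x * (eval q2 b x' - eval q2 b x)); last by ring.
  rewrite (le_trans (ler_normD _ _))// !normrM -expR_half_rsum.
  set E := expR _.
  rewrite (_ : (C1 * B2 + B1 * C2) * (E * E) * D =
    (C1 * E * D) * (B2 * E) + (B1 * E) * (C2 * E * D)); last by ring.
  by rewrite lerD// ler_pM// ?H1 ?H2 ?K1 ?K2.
Qed.

Lemma quad_shift b x i h :
  quad b (x + h *: delta_mx 0 i) - quad b x =
  b i * (2 * (x 0 i - x0 0 i) * h + h ^+ 2).
Proof.
rewrite /quad -sumrB (bigD1 i)//= [X in _ + X]big1 ?addr0.
  by rewrite !mxE !eqxx /=; ring.
by move=> j ji; rewrite !mxE (negbTE ji) andbF mulr0 addr0 subrr.
Qed.

(** A quadratic remainder that is uniform in the rates up to exp(e |b|) survives integration against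
    the weight, so it yields differentiation under the integral without dominated convergence. *)
Lemma eval_taylor q i (e M : R) : 0 < e -> exists2 C : R, 0 <= C &
  forall b x h, (forall i, 0 <= b i) -> near_x0 M x ->
    near_x0 M (x + h *: delta_mx 0 i) ->
    `|eval q b (x + h *: delta_mx 0 i) - eval q b x - h * eval (deriv i q) b x|
      <= C * expR (e * rsum b) * h ^+ 2.
Proof.
elim: q e => [c|j|j| |q1 IH1 q2 IH2|q1 IH1 q2 IH2] e e0 /=.
- by exists 0 => // b x h b0 _ _; rewrite subrr mulr0 subr0 normr0 !mul0r.
- by exists 0 => // b x h b0 _ _; rewrite subrr mulr0 subr0 normr0 !mul0r.
- exists 0 => // b x h b0 _ _; rewrite !mxE eqxx /= (eq_sym j).
  by rewrite (_ : _ - _ - _ = 0) ?normr0 ?mul0r//; ring.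
- have e20 : 0 < e / 2 by lra.
  exists ((2 * `|M| / (e / 2)) ^+ 2 + e^-1) => [|b x h b0 xM xM'].
    by rewrite addr_ge0 ?sqr_ge0// invr_ge0 ltW.
  set x' := x + _.
  have H := quad_shift b x i h; rewrite -/x' in H.
  (* The increment of [quad] is a term linear in h, which produces the derivative, plus b_i h^2,
     which joins the remainder. *)
  rewrite (_ : _ - _ - _ = (expR (- quad b x') - expR (- quad b x) +
      (quad b x' - quad b x) * expR (- quad b x))
     - b i * h ^+ 2 * expR (- quad b x)); last by rewrite H; ring.
  rewrite (le_trans (ler_normB _ _))// -[leRHS]mulrA [leRHS]mulrDl !(mulrA _ _ (h ^+ 2)) lerD//.
    rewrite (le_trans (expRN_taylor _ _)) ?quad_ge0//.
    have xN (z : 'rV[R]_N) : near_x0 M z -> near_x0 `|M| z.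
      by move=> K k; rewrite (le_trans (K k))// ler_norm.
    have xD k : `|x' 0 k - x 0 k| <= `|h|.
      rewrite !mxE addrC addKr normrM; case: (k == i); rewrite ?andbT ?andbF ?normr0 ?mulr0//.
      by rewrite eqxx normr1 mulr1.
    have L := quad_lipschitz b0 (xN _ xM) (xN _ xM') xD.
    rewrite -real_normK ?num_real// -(real_normK (num_real h)).
    rewrite -expR_half_rsum -!expr2 -!exprMn ler_sqr ?nnegrE ?mulr_ge0 ?expR_ge0//; last first.
      by rewrite invr_ge0 ltW.
    rewrite (le_trans L)// (_ : 2 * `|M| / (e / 2) * _ * `|h| =
      (e / 2)^-1 * expR (e / 2 * rsum b) * (2 * `|M| * `|h|)); last by ring.
    by rewrite ler_wpM2r ?mulr_ge0// rsum_le_expR.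
  rewrite ger0_norm ?(mulr_ge0 (mulr_ge0 (b0 i) (sqr_ge0 h)) (expR_ge0 _))//.
  rewrite (@le_trans _ _ (b i * h ^+ 2))//.
    rewrite ler_piMr ?(mulr_ge0 (b0 i) (sqr_ge0 h))//.
    by rewrite -expR0 ler_expR oppr_le0 quad_ge0.
  by rewrite ler_wpM2r ?(sqr_ge0 h)// (le_trans (le_rsum i b0))// rsum_le_expR.
- have [C1 C10 H1] := IH1 e e0; have [C2 C20 H2] := IH2 e e0.
  exists (C1 + C2) => [|b x h b0 xM xM']; first by rewrite addr_ge0.
  set x' := x + _.
  rewrite (_ : _ - _ - _ =
    (eval q1 b x' - eval q1 b x - h * eval (deriv i q1) b x) +
    (eval q2 b x' - eval q2 b x - h * eval (deriv i q2) b x)); last by ring.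
  by rewrite mulrDl mulrDl (le_trans (ler_normD _ _))// lerD ?H1 ?H2.
- have e20 : 0 < e / 2 by lra.
  have [C1 C10 H1] := IH1 _ e20; have [C2 C20 H2] := IH2 _ e20.
  have [B1 B10 K1] := eval_bounded q1 M e20; have [B2 B20 K2] := eval_bounded q2 M e20.
  have [D1 D10 G1] := eval_bounded (deriv i q1) M e20.
  have [L2 L20 J2] := eval_lipschitz q2 M e20.
  exists (C1 * B2 + B1 * C2 + D1 * L2) => [|b x h b0 xM xM'].
    by rewrite !addr_ge0 ?mulr_ge0.
  set x' := x + _.
  rewrite (_ : _ - _ - _ =
    (eval q1 b x' - eval q1 b x - h * eval (deriv i q1) b x) * eval q2 b x' +
    eval q1 b x * (eval q2 b x' - eval q2 b x - h * eval (deriv i q2) b x) +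
    eval (deriv i q1) b x * (h * (eval q2 b x' - eval q2 b x))); last by ring.
  rewrite (le_trans (ler_normD _ _))// (le_trans (lerD (ler_normD _ _) (lexx _)))//.
  rewrite !normrM -expR_half_rsum; set E := expR _.
  rewrite (_ : (C1 * B2 + B1 * C2 + D1 * L2) * (E * E) * h ^+ 2 =
    (C1 * E * h ^+ 2) * (B2 * E) + (B1 * E) * (C2 * E * h ^+ 2)
    + (D1 * E) * (L2 * E * h ^+ 2)); last by ring.
  rewrite lerD//; first by rewrite lerD// ler_pM// ?H1 ?H2 ?K1 ?K2.
  rewrite ler_pM// ?mulr_ge0 ?G1//.
  have xD k : `|x' 0 k - x 0 k| <= `|h|.
    rewrite !mxE addrC addKr normrM; case: (k == i); rewrite ?andbT ?andbF ?normr0 ?mulr0//.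
    by rewrite eqxx normr1 mulr1.
  have := ler_wpM2l (normr_ge0 h) (J2 _ _ _ _ b0 xM xM' xD (normr_ge0 h)).
  move=> H; apply: (le_trans H); by rewrite mulrCA -expr2 real_normK ?num_real.
Qed.

End expressions.

(** * Superpositions of Gaussians *)

Section local_estimates.
Variables (R : realType) (N : nat).
Implicit Types (f : 'rV[R]_N -> R) (x v : 'rV[R]_N).

Lemma coord_le_norm x i : `|x 0 i| <= `|x|.
Proof.
by rewrite [leRHS]/Num.norm /= mx_normrE; apply: (le_bigmax _ (fun i => `|x i.1 i.2|) (0, i)).
Qed.

Lemma continuous_of_lipschitz f x (C : R) : 0 <= C ->
  (forall x', `|x' - x| <= 1 -> `|f x' - f x| <= C * `|x' - x|) ->
  {for x, continuous f}.
Proof.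
move=> C0 H; have FF : Filter (nbhs x) := nbhs_filter x.
apply/(@cvgrPdist_le _ _ _ (nbhs x) FF) => e e0.
apply/nbhs_ballP; exists (Num.min 1 (e / (C + 1))) => [|x'].
  by rewrite /= lt_min ltr01 divr_gt0// ltr_wpDl.
rewrite mx_norm_ball /ball_/= !(distrC _ x') lt_min => /andP[/ltW x'1 /ltW x'e].
rewrite (distrC (f x)) (le_trans (H _ x'1))//.
rewrite ler_pdivlMr ?ltr_wpDl// in x'e.
by rewrite mulrC; apply: le_trans x'e; rewrite ler_wpM2l// lerDl.
Qed.

Lemma is_derive_of_taylor f x v (d C : R) : 0 <= C ->
  (forall h : R, `|h| <= 1 -> `|f (x + h *: v) - f x - h * d| <= C * h ^+ 2) ->
  is_derive x v f d.
Proof.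
move=> C0 H.
have L : h^-1 *: ((f \o shift x) (h *: v) - f x) @[h --> 0^'] --> d.
  apply/cvgrPdist_le => e e0; near=> h.
  have h0 : h != 0 by near: h; exact: nbhs_dnbhs_neq.
  have h1 : `|h| <= 1.
    by near: h; apply: dnbhs0_le.
  have he : `|h| <= e / (C + 1).
    by near: h; apply: dnbhs0_le; rewrite divr_gt0// ltr_wpDl.
  rewrite ler_pdivlMr ?ltr_wpDl// in he.
  have := H _ h1; rewrite /= /shift/= [h *: v + x]addrC.
  set g := f _ - f x => Hg.
  have nh : 0 < `|h| by rewrite normr_gt0.
  rewrite -(ler_pM2l nh) -normrM mulrBr /GRing.scale /= mulrA mulfV// mul1r.
  rewrite distrC (le_trans Hg)// -(real_normK (num_real h)) expr2 mulrCA ler_pM2l//.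
  by rewrite mulrC; apply: le_trans he; rewrite ler_wpM2l// lerDl.
by apply: DeriveDef; [apply/cvg_ex; exists d|apply/cvg_lim].
Unshelve. all: by end_near. Qed.

End local_estimates.

Lemma integrable_of_le_cst d (T : measurableType d) (R : realType)
    (mu : {finite_measure set T -> \bar R}) (f : T -> R) (C : R) :
  measurable_fun setT f -> (forall w, `|f w| <= C) ->
  mu.-integrable setT (EFin \o f).
Proof.
move=> mf fC; apply/integrableP; split; first exact/measurable_EFinP.
apply: (@le_lt_trans _ _ (\int[mu]_w C%:E)%E).
  apply: ge0_le_integral => //.
  - by do 2! apply: measurableT_comp => //.
  - by move=> w _; rewrite lee_fin (le_trans _ (fC w)).
by rewrite integral_cst// ltey_eq fin_numM// fin_num_measure.
Qed.

Lemma Rintegral_le_cst d (T : measurableType d) (R : realType)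
    (mu : {finite_measure set T -> \bar R}) (f : T -> R) (C : R) :
  measurable_fun setT f -> (forall w, `|f w| <= C) ->
  `|\int[mu]_w f w| <= C * fine (mu setT).
Proof.
move=> mf fC; have If := integrable_of_le_cst mu mf fC.
rewrite (le_trans (le_normr_Rintegral _ If))// -Rintegral_cst//.
apply: le_Rintegral => //.
- exact: integrable_norm.
- exact: finite_measure_integrable_cst.
Qed.

Section superposition.
Variables (R : realType) (N : nat) (x0 : 'rV[R]_N) (l : R).
Local Notation Om := 'rV[R]_N.
Local Notation FM := {finite_measure set Om -> \bar R}.
Local Notation eval := (eval x0).
Hypothesis l0 : 0 < l.
Implicit Types (w x : Om) (q : gexp R N) (mu : FM).

Definition absr w : 'I_N -> R := fun i => `|w 0 i|.

(* Thanks to the weight [exp (- l |w|)] the kernel and all its derivatives are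
   bounded in [w], so that [mu] is only required to be finite. *)
Definition superpose_kernel q x w : R := expR (- (l * rsum (absr w))) * eval q (absr w) x.

Definition superpose mu q x : R := \int[mu]_w superpose_kernel q x w.

Lemma absr_ge0 w i : 0 <= absr w i. Proof. exact: normr_ge0. Qed.

Lemma measurable_absr i : measurable_fun setT (fun w : Om => absr w i).
Proof. exact: (measurableT_comp (@normr_measurable R setT) (measurable_coor i)). Qed.

Lemma measurable_eval q x : measurable_fun setT (fun w : Om => eval q (absr w) x).
Proof.
elim: q => [c|i|i| |q1 IH1 q2 IH2|q1 IH1 q2 IH2] /=.
- exact: measurable_cst.
- exact: measurable_absr.
- exact: measurable_cst.
- apply: measurableT_comp; first exact: measurable_expR.
  apply: measurableT_comp; first exact: oppr_measurable.
  apply: measurable_sum => i; apply: measurable_funM => //; exact: measurable_absr.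
- exact: measurable_funD.
- exact: measurable_funM.
Qed.

Lemma measurable_superpose_kernel q x : measurable_fun setT (superpose_kernel q x).
Proof.
apply: measurable_funM; last exact: measurable_eval.
apply: measurableT_comp; first exact: measurable_expR.
apply: measurableT_comp; first exact: oppr_measurable.
apply: measurable_funM => //; apply: measurable_sum => i; exact: measurable_absr.
Qed.

(** The weight cancels exactly the growth in the rates that the estimates allow when they are taken
    with exponent [l]. *)
Lemma expRN_mul (C e : R) w :
  expR (- (l * rsum (absr w))) * (C * expR (l * rsum (absr w)) * e) = C * e.
Proof.
rewrite (_ : _ * _ = (expR (- (l * rsum (absr w))) * expR (l * rsum (absr w))) * (C * e)).
  by rewrite -expRD addNr expR0 mul1r.
by ring.
Qed.

Lemma superpose_kernel_bounded q x : exists C : R, forall w, `|superpose_kernel q x w| <= C.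
Proof.
have [C C0 H] := eval_bounded x0 q `|x - x0| l0.
exists C => w; rewrite normrM ger0_norm ?expR_ge0//.
rewrite -[leRHS]mulr1 -(expRN_mul C 1 w) mulr1 ler_wpM2l ?expR_ge0// H// => i.
  exact: absr_ge0.
by have := coord_le_norm (x - x0) i; rewrite !mxE.
Qed.

Lemma integrable_superpose mu q x : mu.-integrable setT (EFin \o superpose_kernel q x).
Proof.
have [C H] := superpose_kernel_bounded q x.
exact: (integrable_of_le_cst _ (measurable_superpose_kernel q x) H).
Qed.

Let near_bound x x' i : `|x' - x| <= 1 -> `|x' 0 i - x0 0 i| <= `|x - x0| + 1.
Proof.
move=> H; have := coord_le_norm (x' - x0) i; rewrite !mxE => /le_trans; apply.
rewrite (_ : x' - x0 = (x - x0) + (x' - x)); last by rewrite [RHS]addrC addrA subrK.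
by rewrite (le_trans (ler_normD _ _))// lerD2l.
Qed.

Lemma continuous_superpose mu q : continuous (superpose mu q).
Proof.
move=> x; have [C C0 H] := eval_lipschitz x0 q (`|x - x0| + 1) l0.
apply: (@continuous_of_lipschitz _ _ _ _ (C * fine (mu setT))).
  by rewrite mulr_ge0// fine_ge0.
move=> x' xx'; rewrite /superpose -RintegralB//; try exact: integrable_superpose.
rewrite mulrAC; apply: Rintegral_le_cst.
  by apply: measurable_funB; exact: measurable_superpose_kernel.
move=> w; rewrite -mulrBr normrM ger0_norm ?expR_ge0//.
rewrite -(expRN_mul C `|x' - x| w) ler_wpM2l ?expR_ge0// H//.
- exact: absr_ge0.
- by move=> i; apply: near_bound; rewrite subrr normr0.
- by move=> i; exact: near_bound.
- by move=> i; have := coord_le_norm (x' - x) i; rewrite !mxE.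
Qed.

Lemma is_derive_superpose mu q x i :
  is_derive x (delta_mx 0 i) (superpose mu q) (superpose mu (deriv i q) x).
Proof.
have [C C0 H] := eval_taylor x0 q i (`|x - x0| + 1) l0.
apply: (@is_derive_of_taylor _ _ _ _ _ _ (C * fine (mu setT))).
  by rewrite mulr_ge0// fine_ge0.
move=> h h1.
have nh : `|x + h *: delta_mx 0 i - x| <= 1.
  rewrite addrC addKr normrZ mulr_ile1//.
  rewrite [leLHS]/Num.norm /= mx_normrE; apply: bigmax_le => // -[a b] _ /=.
  by rewrite !mxE; case: (_ && _); rewrite ?normr0 ?normr1.
rewrite /superpose -RintegralB//; try exact: integrable_superpose.
rewrite -RintegralZl//; last exact: integrable_superpose.
rewrite -RintegralB//; last 2 first.
- exact: (integrableB measurableT (integrable_superpose mu q _) (integrable_superpose mu q _)).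
- exact: (integrableZl measurableT h (integrable_superpose mu _ _)).
rewrite mulrAC; apply: Rintegral_le_cst.
  apply: measurable_funB; last by apply: measurable_funM => //; exact: measurable_superpose_kernel.
  by apply: measurable_funB; exact: measurable_superpose_kernel.
move=> w; rewrite /superpose_kernel mulrCA -!mulrBr normrM ger0_norm ?expR_ge0//.
rewrite -(expRN_mul C (h ^+ 2) w) ler_wpM2l ?expR_ge0// H//.
- exact: absr_ge0.
- by move=> k; apply: near_bound; rewrite subrr normr0.
- by move=> k; exact: near_bound.
Qed.

Lemma partial_superpose mu q i : partial i (superpose mu q) = superpose mu (deriv i q).
Proof.
by apply/funext => x; have H := is_derive_superpose mu q x i; rewrite /partial derive_val.
Qed.

End superposition.

(** * The Laplacian of a superposition *)

Lemma cvg_bigsum (R : realType) (T : topologicalType) (I : Type) (r : seq I)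
    (f : I -> T -> R) (t : T) :
  (forall i, {for t, continuous (f i)}) ->
  {for t, continuous (fun s => \sum_(i <- r) f i s)}.
Proof.
move=> cf; elim: r => [|i r IH].
  rewrite (_ : (fun _ => _) = cst 0); first exact: cst_continuous.
  by apply/funext => s; rewrite big_nil.
rewrite (_ : (fun _ => _) = (fun s => f i s + \sum_(i <- r) f i s)).
  by apply: cvgD; [exact: cf|exact: IH].
by apply/funext => s; rewrite big_cons.
Qed.

Section flow_equation.
Variables (R : realType) (N : nat) (al : 'I_N -> R) (l : R) (x0 : 'rV[R]_N).
Local Notation Om := 'rV[R]_N.
Local Notation FM := {finite_measure set Om -> \bar R}.
Hypothesis hN : (5 <= N)%N.
Hypothesis hal : forall i, 7 / 2 <= al i.
Hypothesis l0 : 0 < l.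
Hypothesis hl : expR (l * \sum_(i < N) al i) <= 2.
Implicit Types (t : R) (w x : Om) (k : bool) (q : gexp R N) (mu : FM).
Local Notation rate := (rate al).
Local Notation eval := (eval x0).
Local Notation super_kernel := (superpose_kernel x0 l).
Local Notation super := (superpose x0 l).
Local Notation flow_integral := (flow_integral al l).

(** The second derivative of the Gaussian in x_i is (4 b_i^2 (x_i - x0_i)^2 - 2 b_i) times it.
    [gauss_pos] and [gauss_neg] collect the two terms, both with a positive sign. *)
Definition gauss_pos : gexp R N :=
  \big[@Add R N/Cst N 0]_(i < N)
    Mul (Mul (Cst N 4) (Mul (Mul (Rate R i) (Rate R i)) (Mul (Coord R i) (Coord R i))))
        (Gauss R N).

Definition gauss_neg : gexp R N :=
  \big[@Add R N/Cst N 0]_(i < N) Mul (Mul (Cst N 2) (Rate R i)) (Gauss R N).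

Lemma eval_big (F : 'I_N -> gexp R N) b x :
  eval (\big[@Add R N/Cst N 0]_(i < N) F i) b x = \sum_(i < N) eval (F i) b x.
Proof. by rewrite (big_morph (fun q => eval q b x) (id1 := 0) (op1 := +%R)). Qed.

Lemma eval_gauss_pos b x : eval gauss_pos b x =
  (\sum_(i < N) 4 * b i ^+ 2 * (x 0 i - x0 0 i) ^+ 2) * expR (- quad x0 b x).
Proof.
rewrite eval_big mulr_suml; apply: eq_bigr => i _ /=; ring.
Qed.

Lemma eval_gauss_neg b x : eval gauss_neg b x =
  (\sum_(i < N) 2 * b i) * expR (- quad x0 b x).
Proof. by rewrite eval_big mulr_suml. Qed.

Definition flow_rate w t : 'I_N -> R := fun i => beta (rate w i) t.

(** Minus the logarithm of the flow at the point [x] and time [t]. *)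
Definition flow_exponent x w t : R := half_spread al w t + quad x0 (flow_rate w t) x.

Let r0 := rate_ge0 hal.

Lemma absr_flow_point w t : absr (flow_point al (w, t)) = flow_rate w t.
Proof. by apply/funext => i; rewrite /absr mxE ger0_norm// beta_ge0. Qed.

Lemma flow_weight_kernel k q x w t :
  flow_weight al l k w t * super_kernel q x (flow_point al (w, t)) =
  t ^+ k * (expR (- (l * rsum (absr w))) *
            (expR (- half_spread al w t) * eval q (flow_rate w t) x)).
Proof.
rewrite /flow_weight /superpose_kernel absr_flow_point -!mulrA; congr (_ * _).
rewrite !mulrA; congr (_ * _); rewrite -!expRD; congr expR.
by rewrite sumrB /rsum mulrBr; ring.
Qed.

(** This is the heat equation in logarithmic form: minus the derivative is the Laplacian of the
    Gaussian divided by the Gaussian. *)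
Lemma is_derive_flow_exponent x w t : 0 <= t ->
  is_derive t 1 (flow_exponent x w)
    (\sum_(i < N) 2 * flow_rate w t i
     - \sum_(i < N) 4 * flow_rate w t i ^+ 2 * (x 0 i - x0 0 i) ^+ 2).
Proof.
move=> t0.
have H i : is_derive t 1 (fun t => spread (rate w i) t / 2 +
    beta (rate w i) t * (x 0 i - x0 0 i) ^+ 2)
    (2 * flow_rate w t i - 4 * flow_rate w t i ^+ 2 * (x 0 i - x0 0 i) ^+ 2).
  have H1 := is_deriveZ 2^-1 (is_derive_spread (r0 w i) t0).
  have H2 := is_deriveZ ((x 0 i - x0 0 i) ^+ 2) (is_derive_beta (r0 w i) t0).
  have H3 := is_deriveD H1 H2.
  rewrite (_ : (fun _ => _) = 2^-1 \*: spread (rate w i) +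
     (x 0 i - x0 0 i) ^+ 2 \*: beta (rate w i)).
    by apply: (is_derive1_eq H3); rewrite /GRing.scale /= /flow_rate; field.
  by apply/funext => s; rewrite /GRing.scale /= mulrC [X in _ + X]mulrC.
have H' := is_derive_sum H.
rewrite (_ : flow_exponent x w = \sum_(i < N) (fun t => spread (rate w i) t / 2 +
    beta (rate w i) t * (x 0 i - x0 0 i) ^+ 2)).
  by apply: (is_derive1_eq H'); rewrite sumrB.
apply/funext => s; rewrite fct_sumE big_split.
by rewrite /flow_exponent /half_spread /quad.
Qed.

Lemma continuous_eval_comp q x (b : R -> 'I_N -> R) t :
  (forall i, {for t, continuous (fun s => b s i)}) ->
  {for t, continuous (fun s => eval q (b s) x)}.
Proof.
move=> cb; elim: q => [c|i|i| |q1 IH1 q2 IH2|q1 IH1 q2 IH2] /=.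
- exact: cvg_cst.
- exact: cb.
- exact: cvg_cst.
- apply: (@continuous_comp _ _ _ (fun s => - quad x0 (b s) x) expR); last exact: continuous_expR.
  apply: cvgN; apply: cvg_bigsum => i; apply: cvgM; first exact: cb.
  exact: cvg_cst.
- by apply: cvgD.
- by apply: cvgM.
Qed.

Lemma continuous_half_spread w t : 0 <= t -> {for t, continuous (half_spread al w)}.
Proof.
move=> t0; apply: cvg_bigsum => i; apply: cvgM; last exact: cvg_cst.
exact: continuous_spread.
Qed.

Lemma continuous_flow_kernel k q x w t : 0 <= t ->
  {for t, continuous (fun t => t ^+ k * (expR (- (l * rsum (absr w))) *
            (expR (- half_spread al w t) * eval q (flow_rate w t) x)))}.
Proof.
move=> t0; apply: cvgM; first by apply: exprn_continuous.
apply: cvgM; first exact: cvg_cst.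
apply: cvgM.
  apply: (@continuous_comp _ _ _ (fun s => - half_spread al w s) expR); last exact: continuous_expR.
  by apply: cvgN; exact: continuous_half_spread.
apply: continuous_eval_comp => i; exact: continuous_beta.
Qed.

Let itv0y := `[(0%R : R), +oo[%classic : set (measurableTypeR R).
Let leb := (@lebesgue_measure R).

Lemma flow_integral_kernel k q x w :
  flow_integral k (EFin \o super_kernel q x) w =
  (\int[leb]_(t in itv0y) (t ^+ k * (expR (- (l * rsum (absr w))) *
            (expR (- half_spread al w t) * eval q (flow_rate w t) x)))%:E)%E.
Proof.
by apply: eq_integral => t _; rewrite /comp -EFinM flow_weight_kernel.
Qed.

Lemma eval_gauss_neg_ge0 b x : (forall i, 0 <= b i) -> 0 <= eval gauss_neg b x.
Proof.
move=> b0; rewrite eval_gauss_neg mulr_ge0 ?expR_ge0// sumr_ge0// => i _.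
by rewrite mulr_ge0.
Qed.

Lemma eval_gauss_pos_ge0 b x : (forall i, 0 <= b i) -> 0 <= eval gauss_pos b x.
Proof.
move=> b0; rewrite eval_gauss_pos mulr_ge0 ?expR_ge0// sumr_ge0// => i _.
by apply: mulr_ge0; [apply: mulr_ge0|]; rewrite ?sqr_ge0.
Qed.

(** What integration by parts in t leaves over: for [k = false] the value at t = 0, for [k = true]
    the integral of the flow, coming from the derivative of the factor t. *)
Definition flow_source k x w : \bar R :=
  if k then flow_integral false (EFin \o super_kernel (Gauss R N) x) w
  else (expR (- quad x0 al x) * super_kernel (Gauss R N) x w)%:E.

(* The heat equation [d/dt H = Laplacian H] for the flow [H] of a Gaussian,
   integrated by parts against [t^k]; the Laplacian is split into its positive
   and negative parts so that all the integrals are nonnegative. *)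
Lemma flow_integral_gauss k x w :
  flow_integral k (EFin \o super_kernel gauss_neg x) w =
  (flow_integral k (EFin \o super_kernel gauss_pos x) w + flow_source k x w)%E.
Proof.
have fr0 t i : 0 <= t -> 0 <= flow_rate w t i by move=> t0; rewrite beta_ge0.
set K := expR (- (l * rsum (absr w))).
have K0 : 0 <= K by exact: expR_ge0.
pose f k t : R := t ^+ k * (K * (expR (- half_spread al w t) * eval gauss_pos (flow_rate w t) x)).
pose g k t : R := t ^+ k * (K * (expR (- half_spread al w t) * eval gauss_neg (flow_rate w t) x)).
pose h t : R :=
  t ^+ false * (K * (expR (- half_spread al w t) * eval (Gauss R N) (flow_rate w t) x)).
have hE t : h t = K * expR (- flow_exponent x w t).
  by rewrite /h expr0 mul1r /= -expRD /flow_exponent opprD.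
have f0 j t : 0 <= t -> 0 <= f j t.
  move=> t0; rewrite !mulr_ge0 ?exprn_ge0 ?expR_ge0// eval_gauss_pos_ge0// => i.
  exact: fr0.
have g0 j t : 0 <= t -> 0 <= g j t.
  move=> t0; rewrite !mulr_ge0 ?exprn_ge0 ?expR_ge0// eval_gauss_neg_ge0// => i.
  exact: fr0.
have h0 t : 0 <= h t by rewrite hE mulr_ge0// expR_ge0.
have dh t : 0 <= t -> is_derive t 1 h (f false t - g false t).
  move=> t0; have H := is_derive_flow_exponent x w t0.
  have H1 : is_derive t 1 (fun t => - flow_exponent x w t) (- (\sum_(i < N) 2 * flow_rate w t i
     - \sum_(i < N) 4 * flow_rate w t i ^+ 2 * (x 0 i - x0 0 i) ^+ 2)) by exact: is_deriveN.
  have H2 := @is_derive1_comp _ expR (fun t => - flow_exponent x w t) t _ _ (is_derive_expR _) H1.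
  have H3 := is_deriveZ K H2.
  rewrite (_ : h = K \*: (expR \o (fun t => - flow_exponent x w t))); last first.
    by apply/funext => s; rewrite hE.
  apply: (is_derive1_eq H3).
  rewrite /GRing.scale /= /f /g !expr0 !mul1r eval_gauss_pos eval_gauss_neg.
  rewrite /flow_exponent opprD expRD; ring.
(* The boundary term at infinity: it is dominated by a multiple of (1 + 14 t)^(-3/2). *)
have hcv (j : bool) : n%:R ^+ j * h n%:R @[n --> \oo] --> 0.
  apply: (@squeeze_cvgr _ _ _ _ (cst 0) (fun n =>
    K * ((14 ^+ j)^-1 * expR (- ((1 / 2 + 1) * spread (7 / 2) n%:R))))).
  - apply: nearW => n; rewrite mulr_ge0 ?exprn_ge0//= hE mulrCA ler_wpM2l//.
    apply: (le_trans _ (pow_expR_spread_le j (ler0n R n))).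
    rewrite ler_wpM2l ?exprn_ge0// ler_expR lerN2 /flow_exponent.
    rewrite (le_trans (half_spread_ge hN hal w (ler0n R n)))// lerDl quad_ge0// => i.
    exact: fr0.
  - exact: cvg_cst.
  - rewrite -[X in _ --> X](mulr0 K); apply: cvgM; first exact: cvg_cst.
    rewrite -[X in _ --> X](mulr0 (14 ^+ j)^-1); apply: cvgM; first exact: cvg_cst.
    by apply: cvg_expR_spread; lra.
have cf j t : 0 <= t -> {for t, continuous (f j)} by move=> t0; exact: continuous_flow_kernel.
have cg j t : 0 <= t -> {for t, continuous (g j)} by move=> t0; exact: continuous_flow_kernel.
have ch t : 0 <= t -> {for t, continuous h} by move=> t0; exact: continuous_flow_kernel.
rewrite !flow_integral_kernel -/K /flow_source; case: k.
  rewrite flow_integral_kernel -/K.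
  (* The primitive t h(t) has derivative h + t h' and vanishes at 0, so h moves to the positive side
     and there is no boundary term. *)
  refine (etrans (@half_line_integral _ (fun t => f true t + h t) (g true)
    (fun t => t * h t) _ _ _ _ _ _) _).
  - by move=> t t0; rewrite addr_ge0// f0.
  - by move=> t t0; exact: g0.
  - by move=> t t0; apply: cvgD; [exact: cf|exact: ch].
  - by move=> t t0; exact: cg.
  - move=> t t0; have H := is_deriveM (is_derive_id (t : R^o) 1) (dh t t0).
    apply: (is_derive1_eq H).
    by rewrite /GRing.scale /= /f /g !expr1 !expr0; ring.
  - by have := hcv true; under eq_fun do rewrite expr1.
  - rewrite mul0r adde0; under eq_integral do rewrite EFinD.
    rewrite ge0_integralD//.
    + by move=> t; rewrite /= in_itv/= andbT => t0; rewrite lee_fin f0.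
    + by apply/measurable_EFinP; apply: half_line_measurable => t t0; exact: cf.
    + by move=> t _; rewrite lee_fin.
    + by apply/measurable_EFinP; apply: half_line_measurable => t t0; exact: ch.
refine (etrans (@half_line_integral _ (f false) (g false) h _ _ _ _ _ _) _).
- by move=> t t0; exact: f0.
- by move=> t t0; exact: g0.
- by move=> t t0; exact: cf.
- by move=> t t0; exact: cg.
- by have := hcv false; under eq_fun do rewrite expr0 mul1r.
(* At t = 0 the exponents are [al i] + |w_i|, so the factor exp(- p) splits off. *)
- congr (_ + _%:E)%E; rewrite hE /superpose_kernel /= mulrCA; congr (_ * _).
  rewrite -expRD; congr expR; rewrite -opprD; congr (- _).
  rewrite /flow_exponent /half_spread big1 ?add0r; last first.
    by move=> i _; rewrite spread0 mul0r.
  rewrite /quad -big_split; apply: eq_bigr => i _ /=.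
  by rewrite /flow_rate beta0 mulrDl.
Qed.

End flow_equation.

(** * Smooth functions *)

Section smooth_algebra.
Variables (R : realType) (N : nat).
Implicit Types (f g : 'rV[R]_N -> R) (x : 'rV[R]_N) (G : set ('rV[R]_N -> R)).

(** The algebra generated by [G]. When the partial derivatives of the generators stay in it, so do
    all iterated ones; this replaces Leibniz formulas of higher order. *)
Inductive falg G : ('rV[R]_N -> R) -> Prop :=
| falg_cst c : falg G (fun=> c)
| falg_gen f : G f -> falg G f
| falg_add f g : falg G f -> falg G g -> falg G (fun x => f x + g x)
| falg_mul f g : falg G f -> falg G g -> falg G (fun x => f x * g x).

Lemma is_derive_add f g x v (df dg : R) :
  is_derive x v f df -> is_derive x v g dg ->
  is_derive x v (fun y => f y + g y) (df + dg).
Proof. by move=> H1 H2; exact: is_deriveD. Qed.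

Lemma is_derive_mul f g x v (df dg : R) :
  is_derive x v f df -> is_derive x v g dg ->
  is_derive x v (fun y => f y * g y) (f x * dg + g x * df).
Proof. by move=> H1 H2; exact: is_deriveM. Qed.

Lemma partialD f g i : (forall x, derivable f x (delta_mx 0 i)) ->
  (forall x, derivable g x (delta_mx 0 i)) ->
  partial i (fun y => f y + g y) = (fun y => partial i f y + partial i g y).
Proof.
move=> df dg; apply/funext => x; rewrite /partial.
have /derivableP H1 := df x; have /derivableP H2 := dg x.
by have H := is_derive_add H1 H2; rewrite derive_val.
Qed.

Lemma partialM f g i : (forall x, derivable f x (delta_mx 0 i)) ->
  (forall x, derivable g x (delta_mx 0 i)) ->
  partial i (fun y => f y * g y) = (fun y => f y * partial i g y + g y * partial i f y).
Proof.
move=> df dg; apply/funext => x; rewrite /partial.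
have /derivableP H1 := df x; have /derivableP H2 := dg x.
by have H := is_derive_mul H1 H2; rewrite derive_val.
Qed.

Lemma partial_cst c i : partial i (fun=> c : R) = (fun=> 0) :> ('rV[R]_N -> R).
Proof.
by apply/funext => x; rewrite /partial; exact: derive_val.
Qed.

Definition generates G := forall f, G f -> continuous f /\
  forall i, (forall x, derivable f x (delta_mx 0 i)) /\ falg G (partial i f).

Lemma falg_derivable G f : generates G -> falg G f -> continuous f /\
  forall i, (forall x, derivable f x (delta_mx 0 i)) /\ falg G (partial i f).
Proof.
move=> GG; elim=> {f} [c|f Gf|f g af [cf df] ag [cg dg]|f g af [cf df] ag [cg dg]].
- split; first by move=> x; exact: cst_continuous.
  by move=> i; rewrite partial_cst; split; [move=> x; exact: derivable_cst|exact: falg_cst].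
- exact: GG.
- split; first by move=> x; exact: continuousD (cf x) (cg x).
  move=> i; have [df1 df2] := df i; have [dg1 dg2] := dg i.
  split; first by move=> x; apply: derivableD.
  by rewrite partialD//; exact: falg_add.
- split; first by move=> x; exact: continuousM (cf x) (cg x).
  move=> i; have [df1 df2] := df i; have [dg1 dg2] := dg i.
  split; first by move=> x; apply: derivableM.
  by rewrite partialM//; apply: falg_add; exact: falg_mul.
Qed.

Lemma falg_smooth G f : generates G -> falg G f -> smooth f.
Proof.
move=> GG af k.
have H s : falg G (partials s f).
  by elim: s => //= i s IH; have [_ /(_ i)[]] := falg_derivable GG IH.
split=> s _; first by have [] := falg_derivable GG (H s).
by move=> i x; have [_ /(_ i)[]] := falg_derivable GG (H s).
Qed.

Lemma falg_sum G (I : Type) (r : seq I) (f : I -> 'rV[R]_N -> R) :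
  (forall i, falg G (f i)) -> falg G (fun x => \sum_(i <- r) f i x).
Proof.
move=> af; elim: r => [|i r IH].
  rewrite (_ : (fun _ => _) = (fun=> 0)); first exact: falg_cst.
  by apply/funext => x; rewrite big_nil.
rewrite (_ : (fun _ => _) = (fun x => f i x + \sum_(i <- r) f i x)).
  exact: falg_add.
by apply/funext => x; rewrite big_cons.
Qed.

Lemma partials_cat s1 s2 f : partials (s1 ++ s2) f = partials s1 (partials s2 f).
Proof. by rewrite /partials foldr_cat. Qed.

Lemma smooth_partials f s : smooth f -> smooth (partials s f).
Proof.
move=> sf k; split=> t Ht; rewrite -partials_cat.
  by have [+ _] := sf (size (t ++ s)); apply.
by move=> i x; have [_ +] := sf (size (t ++ s)).+1; apply.
Qed.

Lemma smooth_continuous f : smooth f -> continuous f.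
Proof. by move=> /(_ 0%N)[/(_ [::] isT)]. Qed.

Lemma smooth_derivable f i x : smooth f -> derivable f x (delta_mx 0 i).
Proof. by move=> /(_ 1%N)[_ /(_ [::] isT)]. Qed.

Lemma smooth_generates : generates (@smooth R N).
Proof.
move=> f sf; split; first exact: smooth_continuous.
move=> i; split; first by move=> x; exact: smooth_derivable.
by apply: falg_gen; exact: (smooth_partials [:: i]).
Qed.

Lemma smoothD f g : smooth f -> smooth g -> smooth (fun x => f x + g x).
Proof.
by move=> sf sg; apply: (falg_smooth smooth_generates); apply: falg_add; exact: falg_gen.
Qed.

Lemma smoothM f g : smooth f -> smooth g -> smooth (fun x => f x * g x).
Proof.
by move=> sf sg; apply: (falg_smooth smooth_generates); apply: falg_mul; exact: falg_gen.
Qed.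

Lemma smooth_cst (c : R) : @smooth R N (fun=> c).
Proof. by apply: (falg_smooth smooth_generates); exact: falg_cst. Qed.

Lemma smooth_sum (I : Type) (r : seq I) (f : I -> 'rV[R]_N -> R) :
  (forall i, smooth (f i)) -> smooth (fun x => \sum_(i <- r) f i x).
Proof.
move=> sf; apply: (falg_smooth smooth_generates); apply: falg_sum => i.
exact: falg_gen.
Qed.

Variable x0 : 'rV[R]_N.

Lemma is_derive_coord x i j :
  is_derive x (delta_mx 0 i) (fun y => y 0 j - x0 0 j) (i == j)%:R.
Proof.
apply: (@is_derive_of_taylor _ _ _ _ _ _ 0) => // h _.
rewrite !mxE eqxx /= (eq_sym j) (_ : _ - _ - _ = 0) ?normr0 ?mul0r//; ring.
Qed.

Lemma partial_coord i j : partial i (fun y : 'rV[R]_N => y 0 j - x0 0 j) = (fun=> (i == j)%:R).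
Proof. by apply/funext => x; have H := is_derive_coord x i j; rewrite /partial derive_val. Qed.

Lemma continuous_coord j : continuous (fun y : 'rV[R]_N => y 0 j - x0 0 j).
Proof.
move=> x; apply: (@continuous_of_lipschitz _ _ _ _ 1) => // x' _.
rewrite mul1r (_ : _ - _ = (x' - x) 0 j); last by rewrite !mxE; ring.
exact: coord_le_norm.
Qed.

Lemma smooth_coord j : smooth (fun y : 'rV[R]_N => y 0 j - x0 0 j).
Proof.
apply: (@falg_smooth (range (fun j => (fun y : 'rV[R]_N => y 0 j - x0 0 j)))).
  move=> _ [k _ <-]; split; first exact: continuous_coord.
  move=> i; rewrite partial_coord; split; last exact: falg_cst.
  by move=> x; have H := is_derive_coord x i k.
by apply: falg_gen; exists j.
Qed.

Lemma smooth_quad (b : 'I_N -> R) : smooth (quad x0 b).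
Proof.
apply: smooth_sum => i; apply: smoothM; first exact: smooth_cst.
under eq_fun do rewrite expr2.
by apply: smoothM; exact: smooth_coord.
Qed.

Lemma partial_quad (b : 'I_N -> R) i :
  partial i (quad x0 b) = (fun y => 2 * b i * (y 0 i - x0 0 i)).
Proof.
apply/funext => x; rewrite /partial.
have H j : is_derive x (delta_mx 0 i) (fun y : 'rV[R]_N => b j * (y 0 j - x0 0 j) ^+ 2)
    (2 * b j * (x 0 j - x0 0 j) * (i == j)%:R).
  have H1 := is_derive_coord x i j.
  have H2 := is_derive_mul (is_derive_cst (b j : R^o) x (delta_mx 0 i)) (is_derive_mul H1 H1).
  rewrite (_ : (fun _ => _) = (fun y : 'rV[R]_N => cst (b j) y *
    ((y 0 j - x0 0 j) * (y 0 j - x0 0 j)))); last first.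
    by apply/funext => y; rewrite expr2.
  rewrite (_ : _ * _%:R = cst (b j) x *
      ((x 0 j - x0 0 j) * (i == j)%:R + (x 0 j - x0 0 j) * (i == j)%:R)
    + ((x 0 j - x0 0 j) * (x 0 j - x0 0 j)) * 0); last by rewrite /cst; ring.
  exact: H2.
have H' := is_derive_sum H.
have -> : quad x0 b = \sum_(j < N) (fun y : 'rV[R]_N => b j * (y 0 j - x0 0 j) ^+ 2).
  by apply/funext => y; rewrite fct_sumE.
rewrite derive_val (bigD1 i)//= eqxx mulr1 big1 ?addr0// => j ji.
by rewrite eq_sym (negbTE ji) mulr0.
Qed.

Lemma partial2_quad (b : 'I_N -> R) i :
  partials [:: i; i] (quad x0 b) = (fun=> 2 * b i).
Proof.
rewrite /= partial_quad partialM ?partial_cst ?partial_coord.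
- by apply/funext => y; rewrite eqxx mulr1 mulr0 addr0.
- by move=> x; exact: derivable_cst.
- by move=> x; have H := is_derive_coord x i i.
Qed.

Lemma laplacian_quad (b : 'I_N -> R) : laplacian (quad x0 b) = (fun=> 2 * rsum b).
Proof.
apply/funext => x; rewrite /laplacian mulr_sumr; apply: eq_bigr => i _.
by rewrite partial2_quad.
Qed.

Lemma laplacianD f g : smooth f -> smooth g ->
  laplacian (fun x => f x + g x) = (fun x => laplacian f x + laplacian g x).
Proof.
move=> sf sg; apply/funext => x; rewrite /laplacian -big_split; apply: eq_bigr => i _ /=.
by rewrite !partialD//; move=> y; apply: smooth_derivable => //; exact: (smooth_partials [:: i]).
Qed.

Lemma laplacianZ c f : smooth f -> laplacian (fun x => c * f x) = (fun x => c * laplacian f x).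
Proof.
move=> sf; have H i g : smooth g -> partial i (fun x => c * g x) = (fun x => c * partial i g x).
  move=> sg; rewrite partialM.
  - by rewrite partial_cst; apply/funext => y; rewrite mulr0 addr0.
  - by move=> x; exact: derivable_cst.
  - by move=> x; exact: smooth_derivable.
apply/funext => x; rewrite /laplacian mulr_sumr; apply: eq_bigr => i _ /=.
by rewrite !H//; exact: (smooth_partials [:: i]).
Qed.

Lemma laplacian_cst (c : R) : laplacian (fun=> c) = (fun=> 0) :> ('rV[R]_N -> R).
Proof.
by apply/funext => x; rewrite /laplacian big1// => i _ /=; rewrite !partial_cst.
Qed.

End smooth_algebra.

(** * The solution *)

Section entire_solution.
Variables (R : realType) (N : nat) (al : 'I_N -> R) (l : R) (x0 : 'rV[R]_N).
Local Notation Om := 'rV[R]_N.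
Local Notation FM := {finite_measure set Om -> \bar R}.
Hypothesis hN : (5 <= N)%N.
Hypothesis hal : forall i, 7 / 2 <= al i.
Hypothesis l0 : 0 < l.
Hypothesis hl : expR (l * \sum_(i < N) al i) <= 2.
Implicit Types (t : R) (w x : Om) (k : bool) (q : gexp R N) (mu rho : FM).
Local Notation rate := (rate al).
Local Notation eval := (eval x0).
Local Notation super_kernel := (superpose_kernel x0 l).
Local Notation super := (superpose x0 l).
Local Notation flow_integral := (flow_integral al l).
Local Notation G := (Gauss R N).

Definition is_flow k mu rho :=
  forall g : Om -> \bar R, measurable_fun setT g -> (forall x, 0 <= g x)%E ->
    (\int[rho]_w g w = \int[mu]_w flow_integral k g w)%E.

Lemma superE mu q x : (super mu q x)%:E = (\int[mu]_w (super_kernel q x w)%:E)%E.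
Proof.
rewrite /superpose /Rintegral fineK//.
by apply: integrable_fin_num => //; exact: integrable_superpose.
Qed.

(** The weight exp(- l |w|) shifts every Laplace variable by [l], so an identity between transforms
    on y >= 0 carries over to superpositions. *)
Lemma super_gauss_lap mu x :
  super mu G x = lap mu (fun i => (x 0 i - x0 0 i) ^+ 2 + l).
Proof.
rewrite /superpose /lap; apply: eq_Rintegral => w _.
rewrite /superpose_kernel /lap_kernel /= -expRD; congr expR.
rewrite -opprD; congr (- _); rewrite /rsum /quad mulr_sumr -big_split.
by apply: eq_bigr => i _ /=; rewrite /absr mulrDr addrC (mulrC l).
Qed.

(** The difference of the [gauss_neg] and [gauss_pos] terms is minus a Laplacian. So - Delta sends
    the potential with factor t to the one without it, and the latter to exp(- p) times the
    superposition of [mu]. *)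
Lemma super_flow_gauss k mu rho rho0 x : is_flow k mu rho -> is_flow false mu rho0 ->
  super rho (gauss_neg R N) x = super rho (gauss_pos R N) x +
    (if k then super rho0 G x else expR (- quad x0 al x) * super mu G x).
Proof.
move=> Hr H0; apply: EFin_inj.
have mk q : measurable_fun setT (EFin \o super_kernel q x).
  by apply/measurable_EFinP; exact: measurable_superpose_kernel.
have neg0 w : (0 <= (EFin \o super_kernel (gauss_neg R N) x) w)%E.
  by rewrite lee_fin mulr_ge0 ?expR_ge0// eval_gauss_neg_ge0// => i; exact: absr_ge0.
have pos0 w : (0 <= (EFin \o super_kernel (gauss_pos R N) x) w)%E.
  by rewrite lee_fin mulr_ge0 ?expR_ge0// eval_gauss_pos_ge0// => i; exact: absr_ge0.
have g0 w : (0 <= (EFin \o super_kernel G x) w)%E.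
  by rewrite lee_fin mulr_ge0 ?expR_ge0.
rewrite EFinD !superE (Hr (EFin \o super_kernel (gauss_neg R N) x))//.
rewrite (Hr (EFin \o super_kernel (gauss_pos R N) x))//.
transitivity (\int[mu]_w (flow_integral k (EFin \o super_kernel (gauss_pos R N) x) w +
    flow_source al l x0 k x w))%E.
  by apply: eq_integral => w _; exact: flow_integral_gauss.
have ms : measurable_fun setT (flow_source al l x0 k x).
  case: k {Hr} => /=; first exact: measurable_flow_integral.
  by apply/measurable_EFinP; apply: measurable_funM => //; exact: measurable_superpose_kernel.
have s0 w : (0 <= flow_source al l x0 k x w)%E.
  rewrite /flow_source; case: k {Hr ms}; first exact: flow_integral_ge0.
  by rewrite lee_fin mulr_ge0 ?expR_ge0// mulr_ge0 ?expR_ge0.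
rewrite ge0_integralD//; last 2 first.
- by move=> w _; exact: flow_integral_ge0.
- exact: measurable_flow_integral.
congr (_ + _)%E; rewrite /flow_source; case: k {Hr ms s0}.
  by rewrite superE (H0 (EFin \o super_kernel G x)).
under eq_integral do rewrite EFinM.
rewrite ge0_integralZl//; first by rewrite -superE EFinM.
- exact: mk.
- by move=> w _; exact: g0.
Qed.

Lemma laplacian_super_gauss mu x :
  laplacian (super mu G) x = super mu (gauss_pos R N) x - super mu (gauss_neg R N) x.
Proof.
rewrite /laplacian.
transitivity (\sum_(i < N) super mu (deriv i (deriv i G)) x).
  by apply: eq_bigr => i _; rewrite /= !partial_superpose.
have I := integrable_superpose x0 l0 mu.
transitivity (super mu (\big[@Add R N/Cst N 0]_(i < N) deriv i (deriv i G)) x).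
  rewrite (big_morph (fun q => super mu q x) (id1 := 0) (op1 := +%R))//.
  - move=> q1 q2; rewrite /superpose -RintegralD//; [|exact: I|exact: I].
    by apply: eq_Rintegral => w _; rewrite /superpose_kernel /= mulrDr.
  - rewrite /superpose /Rintegral (eq_integral (fun=> 0%E)) ?integral0//.
    by move=> w _; rewrite /superpose_kernel /= mulr0.
rewrite /superpose -RintegralB//; [|exact: I|exact: I].
apply: eq_Rintegral => w _; rewrite /superpose_kernel -mulrBr; congr (_ * _).
rewrite eval_big eval_gauss_pos eval_gauss_neg -mulrBl -sumrB mulr_suml.
by apply: eq_bigr => i _ /=; rewrite eqxx (_ : true%:R = 1)//; ring.
Qed.

Lemma smooth_super mu q : smooth (super mu q).
Proof.
apply: (@falg_smooth _ _ (range (super mu))); last by apply: falg_gen; exists q.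
move=> _ [p _ <-]; split; first exact: continuous_superpose.
move=> i; split; first by move=> x; have H := is_derive_superpose x0 l0 mu p x i.
by rewrite partial_superpose//; apply: falg_gen; exists (deriv i p).
Qed.

Lemma bilaplacian_flow mu rho rho0 : is_flow true mu rho -> is_flow false mu rho0 ->
  laplacian (laplacian (super rho G)) =
  (fun x => expR (- quad x0 al x) * super mu G x).
Proof.
move=> Hr H0.
have -> : laplacian (super rho G) = (fun x => -1 * super rho0 G x).
  apply/funext => x; rewrite laplacian_super_gauss (super_flow_gauss x Hr H0); ring.
rewrite laplacianZ; last exact: smooth_super.
apply/funext => x; rewrite laplacian_super_gauss (super_flow_gauss x H0 H0); ring.
Qed.

(** The m-th power of 1 + y <= m (1 + y / m) <= m exp(y / m). With m = N - 2 it is the source of the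
    constant in the decay estimate. *)
Lemma pow_le_expR m (y : R) : (0 < m)%N -> 0 <= y -> (1 + y) ^+ m <= m%:R ^+ m * expR y.
Proof.
move=> m0 y0; have m1 : 1 <= m%:R :> R by rewrite ler1n.
have -> : expR y = expR (y / m%:R) ^+ m.
  by rewrite -expRM_natl mulrC divfK// pnatr_eq0 -lt0n.
rewrite -exprMn ler_pXn2r ?nnegrE ?addr_ge0 ?mulr_ge0 ?expR_ge0//.
have := expR_ge1Dx (y / m%:R) => H.
apply: (@le_trans _ _ (m%:R * (1 + y / m%:R))); last by rewrite ler_wpM2l// ler0n.
by rewrite mulrDr mulr1 mulrCA mulfV ?mulr1 ?pnatr_eq0 -?lt0n// lerD2r.
Qed.

(** Powers of r are traded for powers of z = r (1 + 14 t)^(-1/2), which exp(- z^2) absorbs. What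
    remains is r (1 + r^2 + 14 t)^(-3/2), whose integral over t is bounded in r. The last power is
    written with rate (7/2) / (1 + r^2) so that its integral is again one of a power of 1 + 4 b
    t. *)
Lemma decay_pointwise (r t : R) : 0 < r -> 0 <= t ->
  t * expR (- (N%:R / 2 * spread (7 / 2) t + r ^+ 2 * expR (- spread (7 / 2) t)))
    * r ^+ (N - 4) <=
  (N - 2)%:R ^+ (N - 2) / 14 * r *
    ((Num.sqrt (1 + r ^+ 2))^-1 ^+ 3 *
     expR (- ((1 / 2 + 1) * spread (7 / 2 / (1 + r ^+ 2)) t))).
Proof.
move=> r0 t0; have [n Nn] : exists n, N = (n + 5)%N.
  by exists (N - 5)%N; rewrite subnK.
rewrite Nn (_ : n + 5 - 4 = n.+1)%N; last by rewrite addnS -addSn addnK.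
rewrite (_ : n + 5 - 2 = n.+3)%N; last by rewrite -addnBA// addn3.
set M := n.+3%:R ^+ n.+3; set s := spread (7 / 2) t.
have b0 : 0 <= 7 / 2 :> R by lra.
set c := r ^+ 2; have c0 : 0 <= c by exact: sqr_ge0.
have c1 : 0 < 1 + c by rewrite ltr_wpDr.
have b'0 : 0 <= 7 / 2 / (1 + c) by rewrite divr_ge0// ltW.
set s' := spread _ t.
(* [I] is (1 + 14 t)^(-1/2), and [J] below is (1 + r^2 + 14 t)^(-1/2). *)
pose I := expR (- (s / 2)).
have I0 : 0 < I by exact: expR_gt0.
have I2 : I ^+ 2 * (1 + 14 * t) = 1.
  rewrite /I -expRM_natl (_ : 1 + 14 * t = 1 + 4 * (7 / 2) * t); last by field.
  by rewrite -spreadK// -expRD (_ : _ + _ = 0) ?expR0// /s; field.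
pose J := (Num.sqrt (1 + c))^-1 * expR (- (s' / 2)).
have J0 : 0 < J by rewrite mulr_gt0 ?expR_gt0// invr_gt0 sqrtr_gt0.
have J2 : J ^+ 2 * (1 + c + 14 * t) = 1.
  rewrite /J exprMn exprVn sqr_sqrtr ?ltW// -expRM_natl.
  rewrite (_ : 1 + c + 14 * t = (1 + c) * (1 + 4 * (7 / 2 / (1 + c)) * t)); last first.
    by field; rewrite gt_eqF.
  rewrite -spreadK// mulrACA mulVf ?gt_eqF// mul1r -expRD (_ : _ + _ = 0) ?expR0//.
  by rewrite /s'; field.
have -> : expR (- ((1 / 2 + 1) * s')) = expR (- (s' / 2)) ^+ 3.
  by rewrite -expRM_natl; congr expR; field.
rewrite -exprMn -/J.
pose z := r * I.
have z0 : 0 < z by rewrite mulr_gt0.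
have z2 : z ^+ 2 = c * expR (- s).
  by rewrite /z exprMn /I -expRM_natl; congr (_ * expR _); field.
have -> : expR (- ((n + 5)%:R / 2 * s + c * expR (- s))) = I ^+ (n + 5) * expR (- z ^+ 2).
  by rewrite /I -expRM_natl -expRD z2; congr expR; field.
have z21 : 0 < 1 + z ^+ 2 by rewrite ltr_wpDr// sqr_ge0.
(* In fact I^2 = J^2 (1 + z^2); the weaker form avoids square roots of 1 + z^2. *)
have IJ : I <= J * (1 + z ^+ 2).
  rewrite -ler_sqr ?nnegrE ?(mulr_ge0 (ltW J0) (ltW z21)) ?(ltW I0)//.
  have zI : I ^+ 2 * (1 + c + 14 * t) = 1 + z ^+ 2.
    rewrite (_ : _ * _ = I ^+ 2 * (1 + 14 * t) + c * I ^+ 2); last by ring.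
    by rewrite I2 /z exprMn.
  have E : I ^+ 2 = J ^+ 2 * (1 + z ^+ 2).
    have X0 : 1 + c + 14 * t != 0 by rewrite gt_eqF// ltr_wpDr ?mulr_ge0.
    by apply: (mulIf X0); rewrite zI mulrAC J2 mul1r.
  rewrite E [leRHS]exprMn ler_wpM2l ?(sqr_ge0 J)// expr2 ler_peMr//.
    by rewrite addr_ge0// sqr_ge0.
  by rewrite lerDl sqr_ge0.
have zn : z ^+ n <= (1 + z ^+ 2) ^+ n.
  rewrite lerXn2r ?nnegrE ?(ltW z21) ?(ltW z0)//.
  by have := sqr_ge0 (z - 1); nra.
have I3 : I ^+ 3 <= J ^+ 3 * (1 + z ^+ 2) ^+ 3.
  by rewrite -exprMn lerXn2r ?nnegrE ?(mulr_ge0 (ltW J0) (ltW z21)) ?(ltW I0).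
have tI : t * I ^+ 2 <= 14^-1.
  have I20 : 0 < I ^+ 2 by rewrite exprn_gt0.
  by nra.
have P := @pow_le_expR n.+3 (z ^+ 2) isT (sqr_ge0 z).
(* Of the n + 5 factors [I], two pay for t, n combine with r^n into z^n, and three become J^3, the
   integrable power. *)
have -> : t * (I ^+ (n + 5) * expR (- z ^+ 2)) * r ^+ n.+1 =
    r * (t * I ^+ 2) * (z ^+ n * I ^+ 3) * expR (- z ^+ 2).
  set E := expR _; have -> : z ^+ n = r ^+ n * I ^+ n by rewrite /z exprMn.
  rewrite exprD [r ^+ n.+1]exprS. ring.
have [rw zw Iw Jw] := And4 (ltW r0) (ltW z0) (ltW I0) (ltW J0).
apply: (@le_trans _ _ (r * 14^-1 *
   ((1 + z ^+ 2) ^+ n * (J ^+ 3 * (1 + z ^+ 2) ^+ 3)) * expR (- z ^+ 2))).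
  rewrite ler_wpM2r ?expR_ge0// ler_pM//.
  - by rewrite mulr_ge0// mulr_ge0// exprn_ge0.
  - by rewrite mulr_ge0// exprn_ge0.
  - by rewrite ler_wpM2l.
  - by rewrite ler_pM// exprn_ge0.
rewrite (_ : r * 14^-1 * _ * _ = r * 14^-1 * J ^+ 3 *
   ((1 + z ^+ 2) ^+ n.+3 * expR (- z ^+ 2))); last first.
  have -> : (1 + z ^+ 2) ^+ n.+3 = (1 + z ^+ 2) ^+ n * (1 + z ^+ 2) ^+ 3 by rewrite -exprD addn3.
  set E := expR _; set F := _ ^+ n; ring.
rewrite (_ : M / 14 * r * J ^+ 3 = r * 14^-1 * J ^+ 3 * M); last by ring.
rewrite ler_wpM2l//.
  by rewrite mulr_ge0 ?exprn_ge0// mulr_ge0.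
by rewrite expRN ler_pdivrMr ?expR_gt0.
Qed.

Lemma enorm_sqr x : enorm (x - x0) ^+ 2 = \sum_(i < N) (x 0 i - x0 0 i) ^+ 2.
Proof.
rewrite sqr_sqrtr; last by apply: sumr_ge0 => i _; exact: sqr_ge0.
by apply: eq_bigr => i _; rewrite !mxE.
Qed.

(** All rates are at least 7/2, and [spread] and [beta] increase with the rate, so the isotropic
    Gaussian of rate 7/2 controls the flow. The bound is thus uniform in [w] and can be integrated
    against a finite measure. *)
Lemma flow_integral_decay x w : 0 < enorm (x - x0) ->
  (flow_integral true (EFin \o super_kernel G x) w <=
   ((N - 2)%:R ^+ (N - 2) / enorm (x - x0) ^+ (N - 4))%:E)%E.
Proof.
set r := enorm _ => r0; set M := _ ^+ (N - 2).
have M0 : 0 <= M by rewrite exprn_ge0.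
set c := r ^+ 2; have c0 : 0 <= c by exact: sqr_ge0.
have c1 : 0 < 1 + c by rewrite ltr_wpDr.
set q := Num.sqrt (1 + c); have q0 : 0 < q by rewrite sqrtr_gt0.
pose D := M / 14 * r * q^-1 ^+ 3 / r ^+ (N - 4).
have D0 : 0 <= D by rewrite !mulr_ge0 ?invr_ge0 ?exprn_ge0 ?invr_ge0//; exact: ltW.
have b'0 : 0 < 7 / 2 / (1 + c) by rewrite divr_gt0//; lra.
rewrite flow_integral_kernel//.
have mE : measurable_fun `[(0%R : R), +oo[
    (fun t => (expR (- ((1 / 2 + 1) * spread (7 / 2 / (1 + c)) t)))%:E).
  apply/measurable_EFinP; apply: measurable_funTS.
  apply: measurableT_comp; first exact: measurable_expR.
  apply: measurableT_comp; first exact: oppr_measurable.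
  by apply: measurable_funM => //; exact: measurable_spread.
apply: (@le_trans _ _ (\int[lebesgue_measure]_(t in `[(0%R : R), +oo[)
   (D%:E * (expR (- ((1 / 2 + 1) * spread (7 / 2 / (1 + c)) t)))%:E))%E).
  apply: ge0_le_integral => //.
  - move=> t; rewrite /= in_itv/= andbT => t0.
    by rewrite lee_fin !mulr_ge0 ?expR_ge0 ?exprn_ge0.
  - apply/measurable_EFinP; apply: half_line_measurable => t t0.
    exact: continuous_flow_kernel.
  - exact: emeasurable_funM.
  - move=> t; rewrite /= in_itv/= andbT => t0.
    rewrite -EFinM lee_fin expr1.
    apply: (@le_trans _ _ (t * expR (- (N%:R / 2 * spread (7 / 2) t
        + r ^+ 2 * expR (- spread (7 / 2) t))))).
      rewrite ler_wpM2l// -[leRHS]mul1r ler_pM ?mulr_ge0 ?expR_ge0//.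
        rewrite -expR0 ler_expR oppr_le0 mulr_ge0 ?rsum_ge0 ?ltW// => i.
        exact: absr_ge0.
      rewrite /= -expRD ler_expR -opprD lerN2 lerD ?half_spread_ge_dim//.
      rewrite enorm_sqr mulr_suml; apply: ler_sum => i _.
      rewrite mulrC ler_wpM2r ?(sqr_ge0 (x 0 i - x0 0 i))//.
      apply: (@le_trans _ _ (beta (7 / 2) t)).
        by rewrite /beta ler_peMl ?expR_ge0//; lra.
      by rewrite ler_beta// rate_ge.
    rewrite /D [leRHS]mulrAC ler_pdivlMr ?exprn_gt0// (le_trans (decay_pointwise r0 t0))//.
    by rewrite -/q -/c -/M !mulrA.
rewrite ge0_integralZl//.
- rewrite half_line_integral_expR//.
  rewrite -EFinM lee_fin.
  (* 98 = 14 * 7. The factor q^-2 cancels 1 + c, and r / q <= 1 since q^2 = 1 + r^2. *)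
  have -> : D / (4 * (7 / 2 / (1 + c)) * (1 / 2)) =
      M / r ^+ (N - 4) * (98^-1 * (r * q^-1) * (q^-1 ^+ 2 * (1 + c))).
    by rewrite /D; field; rewrite !gt_eqF// exprn_gt0.
  have MM : 0 <= M / r ^+ (N - 4) by rewrite divr_ge0// exprn_ge0// ltW.
  apply: ler_piMr => //.
  rewrite exprVn /q sqr_sqrtr ?(ltW c1)// mulVf ?gt_eqF// mulr1.
  have : r * q^-1 <= 1.
    rewrite ler_pdivrMr// mul1r -(@ler_sqr _ r) ?nnegrE ?(ltW r0) ?(ltW q0)//.
    by rewrite [leRHS]sqr_sqrtr ?(ltW c1)// lerDr ler01.
  have : 0 <= r * q^-1 by rewrite mulr_ge0 ?invr_ge0 ?ltW.
  by rewrite -/q; lra.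
Qed.

Lemma integral_mass mu (c : R) :
  (\int[mu]_w c%:E = c%:E * (lap mu (fun=> 0%R))%:E)%E.
Proof. by rewrite lap_mass -integral_cst. Qed.

Lemma exists_entire_solution : exists v : Om -> R,
  [/\ smooth v, forall x, 0 <= v x <= 1 / 2,
      laplacian (laplacian v) = (fun x => expR (- quad x0 al x + v x)) &
      exists2 C, 0 <= C & forall x, 0 < enorm (x - x0) -> v x <= C / enorm (x - x0) ^+ (N - 4)].
Proof.
have l0' := ltW l0.
have /choice[Top HT] : forall mu, exists rho, is_flow true mu rho.
  by move=> mu; have [rho H] := exists_flow_measure hN hal l0' hl true mu; exists rho.
have mk (y : 'I_N -> R) : measurable_fun setT (EFin \o lap_kernel y : Om -> \bar R).
  by apply/measurable_EFinP; exact: measurable_lap_kernel.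
have k0 (y : 'I_N -> R) w : (0 <= (EFin \o lap_kernel y) w)%E by rewrite lee_fin expR_ge0.
have k4 w : (flow_integral true (EFin \o lap_kernel (fun=> 0%R)) w <= (4^-1)%:E)%E.
  rewrite (_ : EFin \o _ = fun=> 1%E); last first.
    apply/funext => z; rewrite /= /lap_kernel big1 ?oppr0 ?expR0// => i _.
    by rewrite mulr0.
  apply: (le_trans (flow_integral_cst_le hN hal l0' hl true w)).
  by rewrite lee_fin expr1; lra.
have [|||| mu [mu2 muE]] := @exists_exponential_fixed_point _ _ Top
  (fun y w => flow_integral true (EFin \o lap_kernel y) w).
- by move=> y y0; exact: measurable_flow_integral.
- by move=> y w; exact: flow_integral_ge0.
- by move=> y nu y0; rewrite lapE// -(HT nu (EFin \o lap_kernel y)).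
- exact: k4.
have [rho0 H0] := exists_flow_measure hN hal l0' hl false mu.
pose y x i := (x 0 i - x0 0 i) ^+ 2 + l.
have y0 x i : 0 <= y x i by rewrite addr_ge0 ?sqr_ge0.
pose rho := Top mu.
exists (super rho G); split.
- exact: smooth_super.
- move=> x; rewrite super_gauss_lap lap_ge0/=.
  (* The superposition is at most the mass of [rho], and this is at most a quarter of the mass of
     [mu], which is at most 2. *)
  apply: (@le_trans _ _ (lap rho (fun=> 0))).
    rewrite -lee_fin -/(y x) (lapE rho (y0 x)) lapE//; apply: ge0_le_integral => //.
    + by move=> w _; rewrite lee_fin expR_ge0.
    + exact: mk.
    + exact: mk.
    + move=> w _; rewrite lee_fin ler_expR lerN2; apply: ler_sum => i _.
      by rewrite ler_wpM2l//; exact: y0.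
  rewrite -lee_fin lapE// (HT mu (EFin \o lap_kernel (fun=> 0)))//.
  apply: (@le_trans _ _ (\int[mu]_w (4^-1)%:E)%E).
    apply: ge0_le_integral => //.
    + by move=> w _; exact: flow_integral_ge0.
    + exact: measurable_flow_integral.
  rewrite integral_mass -EFinM lee_fin; lra.
(* At the shifted variable [y x] the fixed point identity says that the superposition of [mu] is exp
   of that of [rho]. *)
- rewrite (bilaplacian_flow (HT mu) H0); apply/funext => x.
  by rewrite expRD !super_gauss_lap muE //; exact: y0.
- exists ((N - 2)%:R ^+ (N - 2) * lap mu (fun=> 0)).
    by rewrite mulr_ge0 ?exprn_ge0 ?lap_ge0.
  move=> x r0; rewrite -lee_fin superE.
  have kG z : (0 <= (EFin \o super_kernel G x) z)%E by rewrite lee_fin mulr_ge0 ?expR_ge0.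
  have mG : measurable_fun setT (EFin \o super_kernel G x).
    by apply/measurable_EFinP; exact: measurable_superpose_kernel.
  rewrite (HT mu (EFin \o super_kernel G x))//.
  apply: (@le_trans _ _ (\int[mu]_w ((N - 2)%:R ^+ (N - 2) / enorm (x - x0) ^+ (N - 4))%:E)%E).
    apply: ge0_le_integral => //.
    + by move=> w _; exact: flow_integral_ge0.
    + exact: measurable_flow_integral.
    + by move=> w _; exact: flow_integral_decay.
  by rewrite integral_mass -EFinM lee_fin mulrAC.
Qed.

End entire_solution.

(** * Stability *)

Section borel_rV.
Variables (R : realType) (N : nat).
Local Notation Om := 'rV[R]_N.

(** The sigma-algebra is the one generated by the coordinates, so [U] is exhibited as the countable
    union of the cubes with rational centre and half width 1 / (k + 1) that it contains. *)
Lemma measurable_open_rV (U : set Om) : open U -> measurable U.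
Proof.
move=> oU.
pose side (p : {ffun 'I_N -> rat} * nat) i : set (measurableTypeR R) :=
  `](ratr (p.1 i) - p.2.+1%:R^-1 : R), (ratr (p.1 i) + p.2.+1%:R^-1)[%classic.
pose box p : set Om := [set y : Om | forall i, side p i (y 0 i)].
have mbox p : measurable (box p).
  by apply: (@measurable_box _ _ (side p)) => i; exact: measurable_itv.
pose F n : set Om := if unpickle n is Some p then
  (if `[< box p `<=` U >] then box p else set0) else set0.
have -> : U = \bigcup_n F n; last first.
  apply: bigcupT_measurable => n; rewrite /F; case: (unpickle n) => // p.
  by case: asboolP.
apply/seteqP; split => [x Ux|x [n _]]; last first.
  by rewrite /F; case: (unpickle n) => // p; case: asboolP => // pU; exact: pU.
have : nbhs x U by exact: open_nbhs_nbhs.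
move=> /nbhs_ballP[e /= e0 xU].
(* A cube of half width d that contains x lies within sup distance 2 d of x. *)
have [k ke] : exists k, 2 * k.+1%:R^-1 < e.
  exists (Num.trunc (2 / e)); rewrite -[ltLHS]mulrC mulrC.
  by rewrite ltr_pdivrMr// mulrC -ltr_pdivrMr// truncnS_gt.
have kp : 0 < k.+1%:R^-1 :> R by rewrite invr_gt0.
have /choice[q qP] : forall i, exists q : rat,
    ratr q \in `](x 0 i - k.+1%:R^-1), (x 0 i + k.+1%:R^-1)[.
  by move=> i; apply: rat_in_itvoo; rewrite ltrBlDr -addrA ltrDl addr_gt0.
have aux (X Y Q d r : R) : Q - d < Y -> Y < Q + d -> X - d < Q -> Q < X + d ->
    2 * d < r -> `|X - Y| < r.
  by move=> *; rewrite ltr_norml; apply/andP; split; lra.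
exists (pickle ([ffun i => q i], k)) => //; rewrite /F pickleK.
have -> : `[< box ([ffun i => q i], k) `<=` U >].
  apply/asboolP => y yb; apply: xU; rewrite mx_norm_ball /ball_/=.
  rewrite [ltLHS]/Num.norm /= mx_normrE; apply: bigmax_lt => //= -[a i] _ /=.
  have := yb i; rewrite /side /= ffunE in_itv /= => /andP[y1 y2].
  have := qP i; rewrite in_itv /= => /andP[q1 q2].
  by rewrite ord1 !mxE; exact: (aux _ _ _ _ _ y1 y2 q1 q2 ke).
move=> i; rewrite /side /= ffunE in_itv /=.
have := qP i; rewrite in_itv /= => /andP[q1 q2].
by rewrite ltrBlDr q2 -ltrBlDr q1.
Qed.

Lemma continuous_measurable_rV (f : Om -> R) : continuous f -> measurable_fun setT f.
Proof.
move=> cf; apply: (measurability _ (RGenOInfty.measurableE R)) => //.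
move=> /= _ [_ [x ->] <-]; rewrite setTI; apply: measurable_open_rV.
by apply: open_comp => //; move=> y _; exact: cf.
Qed.

End borel_rV.

(** * Square integrable functions *)

Section square_integrable.
Variables (R : realType) (N : nat).
Local Notation Om := 'rV[R]_N.
Local Notation mu := (lebesgue_rV R N).
Local Notation L2 := (@L2 R N setT).
Implicit Types (f g h b F : Om -> R).

Lemma L2_sqr_integrable f : L2 f -> mu.-integrable setT (EFin \o (fun x => f x ^+ 2)).
Proof.
move=> [mf foo]; apply/integrableP; split.
  by apply/measurable_EFinP; exact: measurable_funX.
rewrite (eq_integral (fun x => (f x ^+ 2)%:E))// => x _.
by rewrite /= ger0_norm// sqr_ge0.
Qed.

Lemma L2_of_integrable f : measurable_fun setT f ->
  mu.-integrable setT (EFin \o (fun x => f x ^+ 2)) -> L2 f.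
Proof.
move=> mf /integrableP[_ foo]; split=> //; move: foo.
rewrite (eq_integral (fun x => (f x ^+ 2)%:E))// => x _.
by rewrite /= ger0_norm// sqr_ge0.
Qed.

Lemma L2_le f g h : measurable_fun setT h -> L2 f -> L2 g ->
  (forall x, h x ^+ 2 <= 2 * (f x ^+ 2 + g x ^+ 2)) -> L2 h.
Proof.
move=> mh Lf Lg hfg; apply: L2_of_integrable => //.
have I := integrableZl measurableT 2
  (integrableD measurableT (L2_sqr_integrable Lf) (L2_sqr_integrable Lg)).
apply: le_integrable I => //.
  by apply/measurable_EFinP; exact: measurable_funX.
move=> x _ /=; rewrite lee_fin (ger0_norm (sqr_ge0 _)) (le_trans (hfg x))//.
exact: ler_norm.
Qed.

Lemma L2B f g : L2 f -> L2 g -> L2 (fun x => f x - g x).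
Proof.
move=> Lf Lg; apply: (L2_le _ Lf Lg).
  by apply: measurable_funB; [case: Lf|case: Lg].
by move=> x; have := sqr_ge0 (f x + g x); rewrite !expr2; nra.
Qed.

Lemma L2D f g : L2 f -> L2 g -> L2 (fun x => f x + g x).
Proof.
move=> Lf Lg; apply: (L2_le _ Lf Lg).
  by apply: measurable_funD; [case: Lf|case: Lg].
by move=> x; have := sqr_ge0 (f x - g x); rewrite !expr2; nra.
Qed.

Lemma L2M_bounded b f (B : R) : measurable_fun setT b -> (forall x, `|b x| <= B) ->
  L2 f -> L2 (fun x => b x * f x).
Proof.
move=> mb bB Lf; apply: L2_of_integrable.
  by apply: measurable_funM => //; case: Lf.
have I := integrableZl measurableT (B ^+ 2) (L2_sqr_integrable Lf).
apply: le_integrable I => //.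
  apply/measurable_EFinP; apply: measurable_funX; apply: measurable_funM => //.
  by case: Lf.
move=> x _ /=; rewrite lee_fin exprMn (normrM (b x ^+ 2)) (normrM (B ^+ 2)) ler_wpM2r//.
rewrite !normrX; apply: lerXn2r; rewrite ?nnegrE//.
by rewrite (le_trans (bB x))// ler_norm.
Qed.

Lemma L2_mul_integrable f g : L2 f -> L2 g ->
  mu.-integrable setT (EFin \o (fun x => f x * g x)).
Proof.
move=> Lf Lg.
have I := integrableD measurableT (L2_sqr_integrable Lf) (L2_sqr_integrable Lg).
apply: le_integrable I => //.
  by apply/measurable_EFinP; apply: measurable_funM; [case: Lf|case: Lg].
move=> x _ /=; rewrite lee_fin [leRHS]ger0_norm ?addr_ge0 ?sqr_ge0// normrM.
rewrite -(real_normK (num_real (f x))) -(real_normK (num_real (g x))) !expr2.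
by have := sqr_ge0 (`|f x| - `|g x|); have := sqr_ge0 (`|f x| + `|g x|); rewrite !expr2; nra.
Qed.

(** Young's inequality, doing the work of Cauchy-Schwarz: small [eta] gives convergence of products,
    and [eta = 1] gives the absorption step of the Rellich inequality. *)
Lemma Rintegral_mul_le f g (eta : R) : 0 < eta -> L2 f -> L2 g ->
  `|\int[mu]_x (f x * g x)| <=
  eta / 2 * \int[mu]_x (f x ^+ 2) + (2 * eta)^-1 * \int[mu]_x (g x ^+ 2).
Proof.
move=> e0 Lf Lg; have If := L2_sqr_integrable Lf; have Ig := L2_sqr_integrable Lg.
rewrite (le_trans (le_normr_Rintegral measurableT (L2_mul_integrable Lf Lg)))//.
rewrite -RintegralZl// -RintegralZl// -RintegralD//.
- apply: le_Rintegral => //.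
  + exact: (integrable_norm (L2_mul_integrable Lf Lg)).
  + exact: (integrableD measurableT (integrableZl measurableT _ If)
      (integrableZl measurableT _ Ig)).
  + move=> x _; rewrite normrM.
    rewrite -(real_normK (num_real (f x))) -(real_normK (num_real (g x))).
    rewrite -subr_ge0 (_ : _ - _ = (eta * `|f x| - `|g x|) ^+ 2 / (2 * eta)).
      by rewrite divr_ge0 ?sqr_ge0// ltW// mulr_gt0.
    by field; rewrite gt_eqF.
- exact: (integrableZl measurableT _ If).
- exact: (integrableZl measurableT _ Ig).
Qed.

(** With d = 1 / (n + 1), Young's inequality with parameter d and squared error d^2 makes both terms
    of order d. *)
Lemma cvg_Rintegral_mul F f (fn : nat -> Om -> R) : L2 F -> L2 f ->
  (forall n, L2 (fn n)) ->
  (forall n, \int[mu]_x ((f x - fn n x) ^+ 2) <= n.+1%:R^-1 ^+ 2) ->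
  \int[mu]_x (F x * fn n x) @[n --> \oo] --> \int[mu]_x (F x * f x).
Proof.
move=> LF Lf Lfn H.
set C := \int[mu]_x (F x ^+ 2).
have C0 : 0 <= C by apply: Rintegral_ge0 => x _; exact: sqr_ge0.
have K n : `|\int[mu]_x (F x * f x) - \int[mu]_x (F x * fn n x)| <= (C + 1) * n.+1%:R^-1.
  rewrite -RintegralB//; [|exact: L2_mul_integrable|exact: L2_mul_integrable].
  rewrite (@eq_Rintegral _ _ _ mu setT (fun x => F x * (f x - fn n x))); last first.
    by move=> x _; rewrite mulrBr.
  have e0 : 0 < n.+1%:R^-1 :> R by rewrite invr_gt0.
  rewrite (le_trans (Rintegral_mul_le e0 LF (L2B Lf (Lfn n))))// -/C.
  set d := n.+1%:R^-1 in e0 H *.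
  have -> : (C + 1) * d = d * C + d by ring.
  rewrite lerD//; first by rewrite ler_wpM2r//; lra.
  rewrite ler_pdivrMl ?mulr_gt0// (le_trans (H n))// expr2 -mulrA.
  by have := mulr_gt0 e0 e0; rewrite -/d; lra.
apply/cvgrPdist_le => e e0; near=> n.
rewrite (le_trans (K n))// ler_pdivrMr//.
rewrite mulrC -ler_pdivrMr//.
apply: (@le_trans _ _ n%:R); last by rewrite ler_nat.
by near: n; exact: nbhs_infty_ger.
Unshelve. all: by end_near. Qed.

End square_integrable.

(** * The weight 1 / (1/2 + |x - x0|^2) *)

Section weight.
Variables (R : realType) (N : nat) (x0 : 'rV[R]_N).
Local Notation Om := 'rV[R]_N.
Implicit Types (x : Om) (i : 'I_N).

Local Notation sqd := (quad x0 (fun=> 1)).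
Local Notation X i := (fun x : Om => x 0 i - x0 0 i).

(** A regularised |x - x0|^-2, whose square is a weight of Rellich type. The added constant makes it
    smooth, with the derivatives used below bounded; 1/2 is small enough for the square, which is 4
    at [x0], to dominate exp u. *)
Definition weight x : R := (2^-1 + sqd x)^-1.

Lemma sqd_ge0 x : 0 <= sqd x. Proof. exact: quad_ge0. Qed.

Lemma sqdE x : sqd x = \sum_(i < N) (x 0 i - x0 0 i) ^+ 2.
Proof. by apply: eq_bigr => i _; rewrite mul1r. Qed.

Lemma weight_den_gt0 x : 0 < 2^-1 + sqd x.
Proof. by rewrite ltr_pwDl// sqd_ge0. Qed.

Lemma weight_gt0 x : 0 < weight x.
Proof. by rewrite invr_gt0 weight_den_gt0. Qed.

Lemma smooth_weight_den : smooth (fun x => 2^-1 + sqd x).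
Proof. by apply: smoothD; [exact: smooth_cst|exact: smooth_quad]. Qed.

Lemma derivable_weight i x : derivable weight x (delta_mx 0 i).
Proof.
apply: derivableV; first by rewrite gt_eqF// weight_den_gt0.
by apply: smooth_derivable; exact: smooth_weight_den.
Qed.

Lemma partial_weight i : partial i weight = (fun x => -2 * (X i x * (weight x * weight x))).
Proof.
apply/funext => x; rewrite /partial /weight deriveV.
- have -> : 'D_(delta_mx 0 i) (fun x : Om => 2^-1 + sqd x) x =
     partial i (fun x => (fun=> 2^-1) x + sqd x) x by [].
  rewrite partialD ?partial_cst ?partial_quad.
  + by rewrite add0r mulr1 /GRing.scale /= -exprVn expr2; ring.
  + by move=> y; exact: derivable_cst.
  + by move=> y; apply: smooth_derivable; exact: smooth_quad.
- by rewrite gt_eqF// weight_den_gt0.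
- by apply: smooth_derivable; exact: smooth_weight_den.
Qed.

Lemma continuous_weight : continuous weight.
Proof.
move=> x; have n0 : 2^-1 + sqd x != 0 by rewrite gt_eqF// weight_den_gt0.
have H := @continuousV _ _ (fun x => 2^-1 + sqd x) x n0
  (smooth_continuous smooth_weight_den (x := x)).
exact: H.
Qed.

(** The partial derivatives of the weight are polynomials in it and the coordinates, so the weight
    and the smooth functions generate an algebra stable under differentiation. *)
Lemma smooth_weight : smooth weight.
Proof.
pose G : set (Om -> R) := fun f => f = weight \/ smooth f.
apply: (@falg_smooth _ _ G); last by apply: falg_gen; left.
move=> f [->|sf].
  split; first exact: continuous_weight.
  move=> i; split; first by move=> x; exact: derivable_weight.
  rewrite partial_weight; apply: falg_mul; first exact: falg_cst.
  apply: falg_mul; first by apply: falg_gen; right; exact: smooth_coord.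
  by apply: falg_mul; apply: falg_gen; left.
have [cf H] := smooth_generates sf; split => // i; have [H1 _] := H i; split => //.
by apply: falg_gen; right; exact: (smooth_partials [:: i]).
Qed.

Lemma partial2_weight i : partials [:: i; i] weight =
  (fun x => - 2 * weight x ^+ 2 + 8 * (X i x) ^+ 2 * weight x ^+ 3).
Proof.
have dw x : derivable weight x (delta_mx 0 i) by exact: derivable_weight.
have dX x : derivable (X i) x (delta_mx 0 i) by apply: smooth_derivable; exact: smooth_coord.
have dww x : derivable (fun x => weight x * weight x) x (delta_mx 0 i) by exact: derivableM.
have dXww x : derivable (fun x => X i x * (weight x * weight x)) x (delta_mx 0 i).
  exact: (derivableM (dX x) (dww x)).
rewrite /= partial_weight partialM//.
rewrite partial_cst; apply/funext => x.
rewrite (partialM dX dww) (partialM dw dw) partial_coord partial_weight eqxx.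
rewrite (_ : true%:R = 1)//; ring.
Qed.

Lemma weight_le2 x : weight x <= 2.
Proof.
rewrite /weight -[leRHS]invrK lef_pV2 ?posrE ?weight_den_gt0 ?invr_gt0//.
by rewrite lerDl sqd_ge0.
Qed.

Lemma weightK x : (2^-1 + sqd x) * weight x = 1.
Proof. by rewrite mulfV// gt_eqF// weight_den_gt0. Qed.

Lemma sqr_coord_le x i : (x 0 i - x0 0 i) ^+ 2 <= sqd x.
Proof.
rewrite sqdE (bigD1 i)//= lerDl; apply: sumr_ge0 => j _; exact: sqr_ge0.
Qed.

Lemma norm_weight_le x : `|weight x| <= 2.
Proof. by rewrite gtr0_norm ?weight_gt0// weight_le2. Qed.

Lemma norm_partial_weight_le i x : `|partial i weight x| <= 8.
Proof.
rewrite partial_weight.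
have w0 := weight_gt0 x; have w2 := weight_le2 x; have wK := weightK x.
have Xs := sqr_coord_le x i.
set a := x 0 i - x0 0 i in Xs *; set w := weight x in w0 w2 wK *.
have aw : `|a| * w <= 1.
  (* This gives |a| <= a^2 + 1/4, which is below the denominator of the weight. *)
  have := sqr_ge0 (`|a| - 2^-1); rewrite sqrrB real_normK ?num_real// => H.
  have : `|a| <= 2^-1 + sqd x by nra.
  by rewrite -(ler_pM2r w0) wK.
rewrite normrM (_ : `|-2| = 2 :> R); last by rewrite normrN ger0_norm.
rewrite mulrA normrM normrM (gtr0_norm w0).
have aw0 : 0 <= `|a| * w by rewrite mulr_ge0// ltW.
nra.
Qed.

Lemma norm_partial2_weight_le i x : `|partials [:: i; i] weight x| <= 40.
Proof.
rewrite partial2_weight.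
have w0 := weight_gt0 x; have w2 := weight_le2 x; have wK := weightK x.
have Xs := sqr_coord_le x i.
set a := (x 0 i - x0 0 i) ^+ 2 in Xs *; set w := weight x in w0 w2 wK *.
have a0 : 0 <= a by exact: sqr_ge0.
have aw : a * w <= 1 by nra.
have aw0 : 0 <= a * w by rewrite mulr_ge0// ltW.
rewrite (_ : _ + _ = w ^+ 2 * (8 * (a * w) - 2)); last by ring.
rewrite normrM ger0_norm ?sqr_ge0//.
have : `|8 * (a * w) - 2| <= 10 by rewrite ler_norml; apply/andP; split; lra.
have : w ^+ 2 <= 4 by rewrite expr2; nra.
have : 0 <= w ^+ 2 by exact: sqr_ge0.
have := normr_ge0 (8 * (a * w) - 2).
move: (`|_|) (w ^+ 2) => *; nra.
Qed.

(** The Laplacian is - 2 N s^2 + 8 |x - x0|^2 s^3, and |x - x0|^2 s <= 1, so it is at most (8 - 2 N)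
    s^2. *)
Lemma laplacian_weight_le (hN : (5 <= N)%N) x : laplacian weight x <= - 2 * weight x ^+ 2.
Proof.
rewrite /laplacian; under eq_bigr do rewrite partial2_weight.
rewrite big_split/= sumr_const card_ord -mulr_suml -mulr_sumr -sqdE.
have w0 := weight_gt0 x; have wK := weightK x.
rewrite -[Y in Y + _ <= _]mulr_natl.
set w := weight x in w0 wK *; have s0 := sqd_ge0 x.
have sw : sqd x * w <= 1 by nra.
have N5 : 5 <= N%:R :> R by rewrite (ler_nat _ 5).
rewrite (_ : 8 * sqd x * w ^+ 3 = w ^+ 2 * (8 * (sqd x * w))); last by ring.
have w20 : 0 < w ^+ 2 by rewrite exprn_gt0.
nra.
Qed.

End weight.

(** * Test functions and weak derivatives *)

Section test_functions.
Variables (R : realType) (N : nat).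
Local Notation Om := 'rV[R]_N.
Local Notation test := (@test_function R N setT).
Implicit Types (f g psi : Om -> R).

Lemma test_smooth psi : test psi -> smooth psi. Proof. by case. Qed.

Lemma test_mul psi f : test psi -> smooth f -> test (fun x => psi x * f x).
Proof.
move=> [sp [K [cK KT p0]]] sf; split; first exact: smoothM.
by exists K; split => // x Kx; rewrite p0// mul0r.
Qed.

Lemma test_partial psi i : test psi -> test (partial i psi).
Proof.
move=> [sp [K [cK KT p0]]]; split; first exact: (smooth_partials [:: i]).
exists K; split => // x Kx.
have oK : open (~` K) by apply: closed_openC; apply: compact_closed => //; exact: norm_hausdorff.
have nK : \forall y \near x, psi y = cst 0 y.
  have : nbhs x (~` K) by exact: open_nbhs_nbhs.
  by apply: filterS => y; exact: p0.
rewrite /partial (near_eq_derive _ nK); exact: derive_cst.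
Qed.

Local Notation mu := (lebesgue_rV R N).
Local Notation L2 := (@L2 R N setT).
Local Notation weak_partial := (@weak_partial R N setT).

Lemma weak_partial_Rintegral i f g psi : weak_partial i f g -> test psi ->
  \int[mu]_x (f x * partial i psi x) = - \int[mu]_x (g x * psi x).
Proof. by move=> H tp; rewrite /Rintegral (H _ tp) fineN. Qed.

(** The gradients supplied by [sobolev_H10] and by [weak_laplacian] may be different
    representatives; agreement against test functions is enough to pass from one to the other. *)
Lemma weak_partial_unique i f g g' psi : weak_partial i f g -> weak_partial i f g' ->
  test psi -> \int[mu]_x (g x * psi x) = \int[mu]_x (g' x * psi x).
Proof.
move=> H H' tp; apply: oppr_inj.
by rewrite -(weak_partial_Rintegral H tp) (weak_partial_Rintegral H' tp).
Qed.

Lemma Rintegral_sum (I : eqType) (r : seq I) (F : I -> Om -> R) :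
  (forall i, mu.-integrable setT (EFin \o F i)) ->
  mu.-integrable setT (EFin \o (fun x => \sum_(i <- r) F i x)) /\
  \int[mu]_x (\sum_(i <- r) F i x) = \sum_(i <- r) \int[mu]_x F i x.
Proof.
move=> IF; elim: r => [|i r [IH1 IH2]].
  split.
    rewrite (_ : EFin \o _ = cst 0%E); first exact: integrable0.
    by apply/funext => x /=; rewrite big_nil.
  rewrite big_nil /Rintegral (eq_integral (fun=> 0%E)) ?integral0// => x _.
  by rewrite big_nil.
have E : (fun x => \sum_(j <- i :: r) F j x) = (fun x => F i x + \sum_(j <- r) F j x).
  by apply/funext => x; rewrite big_cons.
rewrite E; split; first exact: (integrableD measurableT (IF i) IH1).
by rewrite RintegralD// IH2 big_cons.
Qed.

Lemma L2_sum (I : eqType) (r : seq I) (F : I -> Om -> R) :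
  (forall i, L2 (F i)) -> L2 (fun x => \sum_(i <- r) F i x).
Proof.
move=> LF; elim: r => [|i r IH].
  rewrite (_ : (fun _ => _) = cst 0); last by apply/funext => x; rewrite big_nil.
  apply: L2_of_integrable; first exact: measurable_cst.
  rewrite (_ : EFin \o _ = cst 0%E); first exact: integrable0.
  by apply/funext => x /=; rewrite expr0n.
rewrite (_ : (fun _ => _) = (fun x => F i x + \sum_(j <- r) F j x)); first exact: L2D.
by apply/funext => x; rewrite big_cons.
Qed.

Lemma L2_approx f g (e : R) : L2 f -> measurable_fun setT g ->
  (\int[mu]_x ((f x - g x) ^+ 2)%:E < e%:E)%E ->
  L2 g /\ \int[mu]_x ((f x - g x) ^+ 2) <= e.
Proof.
move=> Lf mg H; have Ld : L2 (fun x => f x - g x).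
  split; first by apply: measurable_funB => //; case: Lf.
  by apply: lt_le_trans H _; rewrite leey.
split.
  rewrite (_ : g = (fun x => f x - (f x - g x))); first exact: L2B.
  by apply/funext => x; rewrite subKr.
rewrite -lee_fin /Rintegral fineK; first exact: ltW.
by apply: integrable_fin_num => //; exact: (L2_sqr_integrable Ld).
Qed.

Lemma H10_approx f (g : 'I_N -> Om -> R) : L2 f -> (forall i, L2 (g i)) ->
  (forall e : R, 0 < e -> exists2 psi, test psi &
      (\int[mu]_x ((f x - psi x) ^+ 2)%:E
       + \sum_(i < N) \int[mu]_x ((g i x - partial i psi x) ^+ 2)%:E < e%:E)%E) ->
  exists psi : nat -> Om -> R, forall n,
    [/\ test (psi n), L2 (psi n), forall i, L2 (partial i (psi n)),
      \int[mu]_x ((f x - psi n x) ^+ 2) <= n.+1%:R^-1 ^+ 2 &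
      forall i, \int[mu]_x ((g i x - partial i (psi n) x) ^+ 2) <= n.+1%:R^-1 ^+ 2].
Proof.
move=> Lf Lg H.
have /choice[psi Hpsi] : forall n : nat, exists psi, test psi /\
      (\int[mu]_x ((f x - psi x) ^+ 2)%:E
       + \sum_(i < N) \int[mu]_x ((g i x - partial i psi x) ^+ 2)%:E
        < (n.+1%:R^-1 ^+ 2)%:E)%E.
  move=> n; have e0 : 0 < n.+1%:R^-1 ^+ 2 :> R by rewrite exprn_gt0// invr_gt0.
  by have [psi tp Hp] := H _ e0; exists psi.
exists psi => n; have [tp Hp] := Hpsi n.
have i0 h : (0 <= \int[mu]_x (h x ^+ 2)%:E)%E.
  by apply: integral_ge0 => x _; rewrite lee_fin sqr_ge0.
have mp := continuous_measurable_rV (smooth_continuous (test_smooth tp)).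
have [|L1 B1] := L2_approx (e := n.+1%:R^-1 ^+ 2) Lf mp.
  by apply: le_lt_trans Hp; rewrite leeDl// sume_ge0.
have K i : L2 (partial i (psi n)) /\
    \int[mu]_x ((g i x - partial i (psi n) x) ^+ 2) <= n.+1%:R^-1 ^+ 2.
  apply: L2_approx => //.
    apply: continuous_measurable_rV; apply: smooth_continuous; apply: test_smooth.
    exact: test_partial.
  apply: le_lt_trans Hp; rewrite (bigD1 i)//= addeCA leeDl// adde_ge0// sume_ge0//.
by split => // i; have [] := K i.
Qed.

End test_functions.

(** * The weighted Rellich inequality *)

Section weighted_rellich.
Variables (R : realType) (N : nat) (x0 : 'rV[R]_N).
Local Notation Om := 'rV[R]_N.
Local Notation mu := (lebesgue_rV R N).
Local Notation L2 := (@L2 R N setT).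
Local Notation s := (weight x0).
Local Notation ds i := (partial i (weight x0)).
Local Notation dds i := (partials [:: i; i] (weight x0)).
Hypothesis hN : (5 <= N)%N.
Implicit Types (phi : Om -> R) (i : 'I_N).

Let ms : measurable_fun setT s.
Proof. apply: continuous_measurable_rV; exact: continuous_weight. Qed.

Let mds i : measurable_fun setT (ds i).
Proof.
apply: continuous_measurable_rV; apply: smooth_continuous.
exact: (smooth_partials [:: i] (smooth_weight x0)).
Qed.

Let mdds i : measurable_fun setT (dds i).
Proof.
apply: continuous_measurable_rV; apply: smooth_continuous.
exact: (smooth_partials [:: i; i] (smooth_weight x0)).
Qed.

Let Ls f : L2 f -> L2 (fun x => s x * f x).
Proof. by apply: L2M_bounded => // x; exact: norm_weight_le. Qed.

Let Lds i f : L2 f -> L2 (fun x => ds i x * f x).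
Proof. by apply: L2M_bounded => // x; exact: norm_partial_weight_le. Qed.

Let Ldds i f : L2 f -> L2 (fun x => dds i x * f x).
Proof. by apply: L2M_bounded => // x; exact: norm_partial2_weight_le. Qed.

(* [phi] cannot be used as a test function; the identity is the limit, along
   test functions [psi] tending to [phi] in H^1, of the weak derivative formulas
   tested with [psi * s] and with [psi * ds i]. *)
Lemma weighted_parts phi (g g' h : 'I_N -> Om -> R) i :
  L2 phi -> (forall i, L2 (g i) /\ weak_partial setT i phi (g i)) ->
  (forall e : R, 0 < e -> exists2 psi, test_function setT psi &
      (\int[mu]_x ((phi x - psi x) ^+ 2)%:E
       + \sum_(i < N) \int[mu]_x ((g i x - partial i psi x) ^+ 2)%:E < e%:E)%E) ->
  weak_partial setT i phi (g' i) ->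
  L2 (h i) /\ weak_partial setT i (g' i) (h i) ->
  \int[mu]_x ((s x * h i x) * phi x) =
  2^-1 * \int[mu]_x ((dds i x * phi x) * phi x) - \int[mu]_x ((s x * g i x) * g i x).
Proof.
move=> Lp Hg Happ wg' [Lh wh].
have Lg j : L2 (g j) by have [] := Hg j.
have wg : weak_partial setT i phi (g i) by have [] := Hg i.
have [psi Hpsi] := H10_approx Lp Lg Happ.
have tp n : test_function setT (psi n) by have [] := Hpsi n.
have Lpsi n : L2 (psi n) by have [] := Hpsi n.
have Ldpsi n : L2 (partial i (psi n)) by have [_ _ /(_ i)] := Hpsi n.
have sp n := test_smooth (tp n).
have dp n x : derivable (psi n) x (delta_mx 0 i) by apply: smooth_derivable.
have ss := smooth_weight x0; have sds := smooth_partials [:: i] ss.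
have dw x : derivable s x (delta_mx 0 i) by exact: smooth_derivable.
have dsw x : derivable (ds i) x (delta_mx 0 i) by exact: smooth_derivable.
have cp F : L2 F -> \int[mu]_x (F x * psi n x) @[n --> \oo] --> \int[mu]_x (F x * phi x).
  by move=> LF; apply: cvg_Rintegral_mul => // n; have [] := Hpsi n.
have cdp F : L2 F ->
    \int[mu]_x (F x * partial i (psi n) x) @[n --> \oo] --> \int[mu]_x (F x * g i x).
  by move=> LF; apply: cvg_Rintegral_mul => // n; have [_ _ _ _ /(_ i)] := Hpsi n.
have intM := @L2_mul_integrable R N.
(* The formula for [h i] is tested with [psi n * s]; the derivative [g' i] that appears is exchanged
   for [g i], the one approximated by the test functions. *)
have E1 n : \int[mu]_x ((s x * h i x) * psi n x) =
    - (\int[mu]_x ((s x * g i x) * partial i (psi n) x))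
    - \int[mu]_x ((ds i x * g i x) * psi n x).
  have t1 := test_mul (tp n) ss; have t2 := test_partial i t1.
  have := weak_partial_unique wg wg' t2.
  rewrite (weak_partial_Rintegral wh t1) partialM// => H.
  rewrite -opprD -RintegralD//; [|exact: intM (Ls (Lg i)) _|exact: intM (Lds i (Lg i)) _].
  apply: oppr_inj; rewrite opprK.
  transitivity (- \int[mu]_x (h i x * (psi n x * s x))).
    by congr (- _); apply: eq_Rintegral => x _; ring.
  by rewrite -H; apply: eq_Rintegral => x _; ring.
have E2 n : \int[mu]_x ((dds i x * phi x) * psi n x)
    + \int[mu]_x ((ds i x * phi x) * partial i (psi n) x) =
    - \int[mu]_x ((ds i x * g i x) * psi n x).
  have := weak_partial_Rintegral wg (test_mul (tp n) sds).
  rewrite partialM// => H.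
  rewrite -RintegralD//; [|exact: intM (Ldds i Lp) _|exact: intM (Lds i Lp) _].
  transitivity (- \int[mu]_x (g i x * (psi n x * ds i x))).
    by rewrite -H; apply: eq_Rintegral => x _ /=; ring.
  by congr (- _); apply: eq_Rintegral => x _; ring.
have F1 : \int[mu]_x ((s x * h i x) * phi x) =
    - (\int[mu]_x ((s x * g i x) * g i x)) - \int[mu]_x ((ds i x * g i x) * phi x).
  have A := cp _ (Ls Lh).
  rewrite -(cvg_lim _ A)//; under eq_fun do rewrite E1.
  apply: cvg_lim => //; apply: cvgB; first by apply: cvgN; apply: cdp; exact: Ls.
  by apply: cp; exact: Lds.
have F2 : \int[mu]_x ((dds i x * phi x) * phi x)
    + \int[mu]_x ((ds i x * phi x) * g i x) =
    - \int[mu]_x ((ds i x * g i x) * phi x).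
  have A : (fun n => \int[mu]_x ((dds i x * phi x) * psi n x)
      + \int[mu]_x ((ds i x * phi x) * partial i (psi n) x)) n @[n --> \oo] -->
      \int[mu]_x ((dds i x * phi x) * phi x) + \int[mu]_x ((ds i x * phi x) * g i x).
    by apply: cvgD; [apply: cp; exact: Ldds|apply: cdp; exact: Lds].
  rewrite -(cvg_lim _ A)//; under eq_fun do rewrite E2.
  by apply: cvg_lim => //; apply: cvgN; apply: cp; exact: Lds.
(* The mixed integrals in [F2] coincide, so each is - 1/2 times the integral of [dds i * phi^2];
   hence the factor 1/2. *)
have F3 : \int[mu]_x ((ds i x * phi x) * g i x) = \int[mu]_x ((ds i x * g i x) * phi x).
  by apply: eq_Rintegral => x _; ring.
rewrite F1; move: F2; rewrite F3; lra.
Qed.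

(** Summing [weighted_parts] over i bounds the integral of w s phi by half that of (Delta s) phi^2,
    the gradient term having the favourable sign. Then Delta s <= - 2 s^2 gives coefficient exactly
    1 for (s phi)^2, and Young's inequality with parameter 1 absorbs half of it. *)
Lemma weighted_rellich phi w :
  sobolev_H10 setT phi -> weak_laplacian setT phi w ->
  (\int[mu]_x ((s x * phi x) ^+ 2)%:E <= \int[mu]_x (w x ^+ 2)%:E)%E.
Proof.
move=> [Lp [g Hg Happ]] [g' [h [Hg' Hh wE]]].
have Lg i : L2 (g i) by have [] := Hg i.
have Lh i : L2 (h i) by have [] := Hh i.
have Lw : L2 w.
  by rewrite (_ : w = fun x => \sum_(i < N) h i x); [exact: L2_sum|exact/funext].
have P i := weighted_parts (h := h) Lp Hg Happ (Hg' i).2 (Hh i).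
have intM := @L2_mul_integrable R N.
have Isp : L2 (fun x => s x * phi x) by exact: Ls.
have H1 : \int[mu]_x (w x * (s x * phi x)) =
    2^-1 * \int[mu]_x (\sum_(i < N) (dds i x * phi x) * phi x)
    - \sum_(i < N) \int[mu]_x ((s x * g i x) * g i x).
  transitivity (\int[mu]_x (\sum_(i < N) (s x * h i x) * phi x)).
    apply: eq_Rintegral => x _; rewrite wE mulr_suml.
    by apply: eq_bigr => i _; ring.
  rewrite (Rintegral_sum _ _).2; last by move=> i; apply: intM => //; exact: Ls.
  rewrite (Rintegral_sum _ _).2; last by move=> i; apply: intM => //; exact: Ldds.
  by rewrite mulr_sumr -sumrB; apply: eq_bigr => i _; exact: P.
have H2 : 0 <= \sum_(i < N) \int[mu]_x ((s x * g i x) * g i x).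
  apply: sumr_ge0 => i _; apply: Rintegral_ge0 => x _.
  by rewrite -mulrA mulr_ge0 ?(ltW (weight_gt0 _ _))// -expr2 sqr_ge0.
have H3 : \int[mu]_x (\sum_(i < N) (dds i x * phi x) * phi x) <=
    - 2 * \int[mu]_x ((s x * phi x) ^+ 2).
  rewrite -RintegralZl//; last exact: L2_sqr_integrable.
  apply: le_Rintegral => //.
  - apply: (Rintegral_sum _ _).1 => i; apply: intM => //; exact: Ldds.
  - exact: (integrableZl measurableT _ (L2_sqr_integrable Isp)).
  - move=> x _; have := laplacian_weight_le x0 hN x.
    move=> /(ler_wpM2r (sqr_ge0 (phi x))); rewrite /laplacian mulr_suml.
    rewrite exprMn (mulrA (- 2) (s x ^+ 2)) => K; apply: (le_trans _ K).
    by rewrite le_eqVlt; apply/orP; left; apply/eqP; apply: eq_bigr => i _; ring.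
have H4 := Rintegral_mul_le (ltr01 : 0 < 1) Lw Isp.
have H5 (a : R) : - a <= `|a| by rewrite -normrN ler_norm.
have {}H5 := H5 (\int[mu]_x (w x * (s x * phi x))).
have fin f : L2 f -> (\int[mu]_x (f x ^+ 2)%:E = (\int[mu]_x (f x ^+ 2))%:E)%E.
  move=> Lf; rewrite /Rintegral fineK//.
  by apply: integrable_fin_num => //; exact: (L2_sqr_integrable Lf).
rewrite (fin _ Isp) (fin _ Lw) lee_fin; lra.
Qed.

Lemma stable_of_le_weight (u : Om -> R) : continuous u ->
  (forall x, expR (u x) <= s x ^+ 2) -> stable u.
Proof.
move=> cu us phi w _ H10 wl; apply: le_trans (weighted_rellich H10 wl).
have mphi : measurable_fun setT phi by case: H10 => -[].
apply: ge0_le_integral => //.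
- by move=> x _; rewrite lee_fin mulr_ge0 ?expR_ge0 ?sqr_ge0.
- apply/measurable_EFinP; apply: measurable_funM; last exact: measurable_funX.
  apply: measurableT_comp; first exact: measurable_expR.
  exact: continuous_measurable_rV.
- by apply/measurable_EFinP; apply: measurable_funX; exact: measurable_funM.
- by move=> x _; rewrite lee_fin exprMn ler_wpM2r// sqr_ge0.
Qed.

End weighted_rellich.

(** * Conclusions *)

Section conclusions.
Variables (R : realType) (N : nat) (x0 : 'rV[R]_N) (al : 'I_N -> R) (v : 'rV[R]_N -> R).
Local Notation Om := 'rV[R]_N.
Hypothesis hN : (5 <= N)%N.
Hypothesis hal : forall i, 7 / 2 <= al i.
Hypothesis sv : smooth v.
Hypothesis vb : forall x, 0 <= v x <= 1 / 2.

Local Notation u := (fun x : Om => v x + -1 * quad x0 al x).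

Lemma smooth_sub_quad : smooth u.
Proof. by apply: smoothD => //; apply: smoothM; [exact: smooth_cst|exact: smooth_quad]. Qed.

Lemma is_solution_sub_quad :
  laplacian (laplacian v) = (fun x => expR (- quad x0 al x + v x)) ->
  is_solution u.
Proof.
move=> vE; split; first exact: smooth_sub_quad.
move=> x; rewrite laplacianD//; last first.
  by apply: smoothM; [exact: smooth_cst|exact: smooth_quad].
rewrite laplacianZ ?laplacian_quad; last exact: smooth_quad.
rewrite laplacianD; last exact: smooth_cst.
  by rewrite vE laplacian_cst addr0 mulN1r addrC.
by apply: smooth_sum => i; exact: (smooth_partials [:: i; i]).
Qed.

Lemma stable_sub_quad : stable u.
Proof.
apply: (stable_of_le_weight (x0 := x0) hN).
  by apply: smooth_continuous; exact: smooth_sub_quad.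
move=> x; have /andP[_ v2] := vb x.
set q := quad x0 (fun=> 1) x.
have q0 : 0 <= q by exact: sqd_ge0.
have qq : 7 / 2 * q <= quad x0 al x.
  rewrite /q /quad mulr_sumr; apply: ler_sum => i _.
  by rewrite mul1r ler_wpM2r// sqr_ge0.
have d0 := weight_den_gt0 x0 x.
(* From v <= 1/2 and p >= 7/2 q follows u <= - 2 z, and exp z >= 1 + z = 3/4 + 7/4 q dominates the
   denominator 1/2 + q. *)
pose z := 7 / 4 * q - 1 / 4.
apply: (@le_trans _ _ (expR (- z) ^+ 2)).
  by rewrite -expRM_natl ler_expR /z; lra.
rewrite lerXn2r ?nnegrE ?expR_ge0// ?(ltW (weight_gt0 _ _))//.
rewrite expRN /weight lef_pV2 ?posrE ?expR_gt0//.
by apply: le_trans (expR_ge1Dx z); rewrite -/q /z; lra.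
Qed.

Lemma enorm_delta (t : R) (i : 'I_N) : enorm (t *: delta_mx 0 i : Om) = `|t|.
Proof.
rewrite /enorm (bigD1 i)//= big1 ?addr0; last first.
  by move=> j ji; rewrite !mxE (negbTE ji) andbF mulr0 expr0n.
by rewrite !mxE !eqxx mulr1 sqrtr_sqr.
Qed.

Lemma eq0_of_bounded_mul (a : R) : (forall t, `|a * t| <= 1) -> a = 0.
Proof.
move=> H; apply/eqP; apply: contraT => a0; have := H (2 / a).
by rewrite mulrCA mulfV// mulr1 ger0_norm//; lra.
Qed.

Lemma not_radial_sub_quad : (exists i j, al i <> al j) -> forall c, ~ radial_about c u.
Proof.
move=> [i [j aij]] c [g ug]; apply: aij.
have E k t : v (c + t *: delta_mx 0 k) - quad x0 al (c + t *: delta_mx 0 k) = g `|t|.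
  by have := ug (c + t *: delta_mx 0 k); rewrite (addrAC c _ (- c)) subrr add0r enorm_delta mulN1r.
have Q k t := quad_shift x0 al c k t.
(* The points c + t e_k and c - t e_k have equal radius. There [quad] differs by 4 [al k] (c_k -
   x0_k) t, linear in t, while [v] differs by at most 1/2. *)
have c0 k : c 0 k - x0 0 k = 0.
  have H : al k * (c 0 k - x0 0 k) = 0.
    apply: eq0_of_bounded_mul => t.
    have E1 := E k t; have E2 := E k (- t); rewrite normrN -E1 in E2.
    have Q1 := Q k t; have Q2 := Q k (- t).
    have /andP[v1 v2] := vb (c + t *: delta_mx 0 k).
    have /andP[w1 w2] := vb (c + (- t) *: delta_mx 0 k).
    rewrite sqrrN in Q2.
    by rewrite ler_norml; apply/andP; split; nra.
  apply: (mulfI (x := al k)); last by rewrite mulr0.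
  by rewrite gt_eqF//; apply: lt_le_trans (hal k); lra.
apply/eqP; rewrite -subr_eq0; apply/eqP; apply: eq0_of_bounded_mul => t.
(* At radius r on the axes i and j, equality of [u] makes ([al i] - [al j]) |t| a difference of two
   values of [v]. *)
pose r := Num.sqrt `|t|.
have rt : r ^+ 2 = `|t| by rewrite sqr_sqrtr.
have E1 := E i r; have E2 := E j r; rewrite -E1 in E2.
have Q1 := Q i r; have Q2 := Q j r; rewrite !c0 !mulr0 !mul0r !add0r rt in Q1 Q2.
have /andP[v1 v2] := vb (c + r *: delta_mx 0 i).
have /andP[w1 w2] := vb (c + r *: delta_mx 0 j).
rewrite normrM -(ger0_norm (normr_ge0 t)) -normrM mulrBl.
by rewrite ler_norml; apply/andP; split; lra.
Qed.

Lemma bigO_sub_quad (C : R) : 0 <= C ->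
  (forall x, 0 < enorm (x - x0) -> v x <= C / enorm (x - x0) ^+ (N - 4)) ->
  bigO_infty (fun x => u x + quad x0 al x) (fun x => enorm x ^ (4 - N%:Z)).
Proof.
move=> C0 H; exists (C * 2 ^+ (N - 4)), (2 * enorm x0 + 1) => x xM.
have e0 (y : Om) : 0 <= enorm y by exact: sqrtr_ge0.
have x1 : 0 < enorm x by have := e0 x0; lra.
have sq (y : Om) : enorm y ^+ 2 = \sum_(i < N) y 0 i ^+ 2.
  by rewrite sqr_sqrtr// sumr_ge0// => i _; exact: sqr_ge0.
have tri : enorm x ^+ 2 <= 2 * enorm (x - x0) ^+ 2 + 2 * enorm x0 ^+ 2.
  rewrite !sq !mulr_sumr -big_split; apply: ler_sum => i _ /=; rewrite !mxE.
  by have := sqr_ge0 (x 0 i - 2 * x0 0 i); rewrite !expr2; nra.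
have hx : enorm x / 2 <= enorm (x - x0).
  rewrite -ler_sqr ?nnegrE ?divr_ge0//.
  by have := e0 x0; move: tri xM; rewrite !expr2; nra.
have r0 : 0 < enorm (x - x0) by apply: lt_le_trans hx; lra.
have /andP[v0 _] := vb x.
rewrite mulN1r subrK ger0_norm//.
have -> : enorm x ^ (4 - N%:Z) = (enorm x ^+ (N - 4))^-1.
  by rewrite -opprB subzn ?(ltnW hN)// -exprnN.
rewrite ger0_norm ?invr_ge0 ?exprn_ge0//.
apply: (le_trans (H x r0)).
rewrite -mulrA ler_wpM2l// -[2 ^+ _]invrK -invfM lef_pV2 ?posrE; last 2 first.
- by rewrite exprn_gt0.
- by rewrite mulr_gt0 ?invr_gt0 ?exprn_gt0.
rewrite -exprVn -exprMn lerXn2r ?nnegrE ?mulr_ge0//.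
by rewrite mulrC.
Qed.

End conclusions.

Theorem theorem1p3 (R : realType) (N : nat) (hN : (5 <= N)%N) :
  exists A : R,
  forall (x0 : 'rV[R]_N) (alpha : 'I_N -> R),
    (forall i, 1 + N%:R / 2 < alpha i) ->
    let p := fun x : 'rV[R]_N =>
      \sum_(i < N) alpha i * (x 0 i - x0 0 i) ^+ 2 in
    exists u : 'rV[R]_N -> R,
      [/\ is_solution u,
          bigO_infty (fun x => u x + p x) (fun x => enorm x ^ (4 - N%:Z)),
          stable_outside_compact u,
          (forall i, A <= alpha i) -> stable u &
          (exists i j, alpha i <> alpha j) -> forall c, ~ radial_about c u].
Proof.
(* [stable_sub_quad] holds for all admissible [alpha], so any threshold does. *)
exists 0 => x0 al hal p.
have N5 : 5 <= N%:R :> R by rewrite (ler_nat _ 5).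
have al72 i : 7 / 2 <= al i by have := hal i; lra.
have i0 : 'I_N by apply: (@Ordinal _ 0); exact: leq_trans hN.
have S0 : 0 < \sum_(i < N) al i.
  rewrite (bigD1 i0)//= ltr_pwDl//; first by apply: lt_le_trans (al72 i0); lra.
  by apply: sumr_ge0 => i _; apply: le_trans (al72 i); lra.
(* Chosen so that l sum_i [al i] = 1/2, whose exponential is at most 2. *)
pose l := 2^-1 / \sum_(i < N) al i.
have l0 : 0 < l by rewrite divr_gt0.
have hl : expR (l * \sum_(i < N) al i) <= 2.
  by rewrite /l divfK ?gt_eqF// expR_half_le2.
have [v [sv vb vE [C C0 vC]]] := exists_entire_solution x0 hN al72 l0 hl.
have st := stable_sub_quad x0 hN al72 sv vb.
exists (fun x => v x + -1 * quad x0 al x); split => //.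
- exact: is_solution_sub_quad.
- exact: (bigO_sub_quad al hN vb C0 vC).
- by exists set0; [exact: compact0|rewrite setC0].
- exact: not_radial_sub_quad al72 vb.
Qed.
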